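(* Let $G$ be a finite $2$-group containing a central element $z$ of order $2$ which is a commutator and such that $G/\langle z\rangle$ is abelian. Let $n$ be the order of $G$, let $N/\mathbb{Q}_2$ be a finite Galois extension containing all $n$-th roots of unity, and let $\mathbb{Q}_2\subseteq K\subseteq M\subseteq N$ be intermediate fields with $M/K$ Galois. Then $$\mathrm{Det}(O_M[G]^* )^{\mathrm{Gal}(M/K)} \cong \mathrm{Det}(O_K[G]^* ).$$
   Context: $O_K, O_M, O_N$ denote the valuation rings of $K, M, N$. The complex representation ring $R(G)$ is identified with $K_0(N[G])$, generated by representations $T: G\to GL_u(N)$; $\mathrm{Gal}(N/K)$ acts on it by acting on matrix entries. For $E \in\{K,M\}$, the determinantal homomorphism $\mathrm{Det}: O_E[G]^*\to \mathrm{Hom}_{\mathrm{Gal}(N/E)}(R(G),O_N^* )$ is given on representations by $\mathrm{Det}(\sum_\gamma\lambda_\gamma\gamma)(T) = \det(\sum_\gamma\lambda_\gamma T(\gamma))$, and $\mathrm{Det}(O_E[G]^* )$ is its image. An element $\sigma\in\mathrm{Gal}(M/K)$ acts on $f\in\mathrm{Hom}_{\mathrm{Gal}(N/M)}(R(G),O_N^* )$ by $(\sigma\cdot f)(T)=\tilde\sigma(f(\tilde\sigma^{-1}(T)))$, where $\tilde\sigma\in\mathrm{Gal}(N/K)$ is any lift of $\sigma$; this restricts to an action on $\mathrm{Det}(O_M[G]^* )$, with $\sigma\cdot\mathrm{Det}(u)=\mathrm{Det}(\sigma(u))$ where $\sigma$ acts on $O_M[G]$ through the coefficients. The superscript $\mathrm{Gal}(M/K)$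 denotes the subgroup of invariants. *)

(* Defs.v *)
From HB Require Import structures.
From Corelib Require Import Setoid Morphisms.
From mathcomp Require Import all_boot all_order all_algebra all_fingroup.
From mathcomp Require Import all_solvable all_field all_character.
From mathcomp Require Import generic_quotient boolp reals.

Set Implicit Arguments.
Unset Strict Implicit.
Unset Printing Implicit Defensive.

Import Order.TTheory GRing.Theory Num.Theory.

Local Open Scope quotient_scope.
Local Open Scope ring_scope.

Record nonarch_abs (R : realType) (F : fieldType) := NonarchAbs {
  abs_val :> F -> R;
  abs_ge0 : forall x, 0 <= abs_val x;
  abs_eq0 : forall x, (abs_val x == 0) = (x == 0);
  absM : forall x y, abs_val (x * y) = abs_val x * abs_val y;
  absD : forall x y, abs_val (x + y) <= Num.max (abs_val x) (abs_val y)
}.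

Definition padic_abs (R : realType) (p : nat) (q : rat) : R :=
  if q == 0 then 0
  else p%:R ^ ((logn p `|denq q|)%:Z - (logn p `|numq q|)%:Z).

(* [F] with [a] is a completion of the rationals for the [p]-adic absolute
   value. This forces [F] to have characteristic 0, so that [ratr] is the
   embedding of the rationals, and it determines [F] and [a] up to a unique
   isomorphism. *)
Record is_Qp (p : nat) (R : realType) (F : fieldType) (a : nonarch_abs R F) :
    Prop := IsQp {
  Qp_ratr : forall q : rat, a (ratr q) = padic_abs R p q;
  Qp_dense : forall (x : F) (e : R), 0 < e -> exists q : rat, a (x - ratr q) < e;
  Qp_complete : forall u : nat -> F,
    (forall e : R, 0 < e -> exists n0, forall m n,
      (n0 <= m)%N -> (n0 <= n)%N -> a (u m - u n) < e) ->
    exists l : F, forall e : R, 0 < e -> exists n0, forall n,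
      (n0 <= n)%N -> a (u n - l) < e
}.

Section ValuationRing.
Variables (R : realType) (F : fieldType) (N : splittingFieldType F).
Variable a : nonarch_abs R N.

Definition val_ring (E : {subfield N}) : {pred N} :=
  [pred x | (x \in E) && (a x <= 1)].

Definition val_ring_unit (E : {subfield N}) : {pred N} :=
  [pred x | [&& x != 0, x \in val_ring E & x^-1 \in val_ring E]].

End ValuationRing.

Section AbsTheory.
Variables (R : realType) (F : fieldType) (a : nonarch_abs R F).

Lemma abs0 : a 0 = 0.
Proof. by apply/eqP; rewrite abs_eq0. Qed.

Lemma abs1 : a 1 = 1.
Proof.
have n0 : a 1 != 0 by rewrite abs_eq0 oner_eq0.
by apply: (mulIf n0); rewrite -absM !mul1r.
Qed.

Lemma absN1 : a (-1) = 1.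
Proof.
apply/eqP; rewrite -(@pexpr_eq1 _ _ 2) ?abs_ge0 //.
by rewrite expr2 -absM mulrNN mulr1 abs1.
Qed.

Lemma absN x : a (- x) = a x.
Proof. by rewrite -mulN1r absM absN1 mul1r. Qed.

Lemma absV x : a x^-1 = (a x)^-1.
Proof.
have [->|x0] := eqVneq x 0; first by rewrite invr0 abs0 invr0.
have ax0 : a x != 0 by rewrite abs_eq0.
by apply: (mulfI ax0); rewrite -absM !divff // abs1.
Qed.

Lemma absX x k : a (x ^+ k) = a x ^+ k.
Proof. by elim: k => [|k IH]; rewrite ?expr0 ?abs1 // !exprS absM IH. Qed.

Lemma abs_sum_le (I : Type) (r : seq I) (P : pred I) (f : I -> F) (b : R) :
  0 <= b -> (forall i, P i -> a (f i) <= b) -> a (\sum_(i <- r | P i) f i) <= b.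
Proof.
move=> b0 fb; elim/big_ind: _ => //; first by rewrite abs0.
by move=> x y xb yb; apply: le_trans (absD _ _ _) _; rewrite ge_max xb yb.
Qed.

Lemma abs_prod_le (I : Type) (r : seq I) (f : I -> F) (b : R) :
  (forall i, a (f i) <= b) -> a (\prod_(i <- r) f i) <= b ^+ size r.
Proof.
move=> fb; elim: r => [|i r IH]; first by rewrite big_nil abs1.
by rewrite big_cons absM /= exprS ler_pM ?abs_ge0.
Qed.

Lemma abs_det_le n (A : 'M[F]_n) (b : R) :
  0 <= b -> (forall i j, a (A i j) <= b) -> a (\det A) <= b ^+ n.
Proof.
move=> b0 Ab; apply: abs_sum_le => [|s _]; first exact: exprn_ge0.
rewrite absM absX absN1 expr1n mul1r.
apply: le_trans (abs_prod_le _ (fun i => Ab i (s i))) _.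
by rewrite /index_enum -enumT size_enum_ord.
Qed.

Lemma bounded_powers_le1 (x b : R) : (forall k, x ^+ k <= b) -> x <= 1.
Proof.
move=> xb; rewrite leNgt; apply/negP => x1.
have d0 : 0 < x - 1 by rewrite subr_gt0.
have bern k : 1 + (x - 1) *+ k <= x ^+ k.
  elim: k => [|k IH]; first by rewrite mulr0n addr0 expr0.
  rewrite exprS mulrS addrCA addrC.
  have -> : x * x ^+ k = x ^+ k + (x - 1) * x ^+ k.
    by rewrite mulrBl mul1r addrC subrK.
  apply: lerD => //; rewrite ler_peMr ?(ltW d0) //.
  by apply: exprn_ege1; exact: ltW.
have b0 : 0 <= b by apply: le_trans (xb 0); rewrite expr0 ler01.
pose k := Num.bound (b / (x - 1)).
have : b < (x - 1) *+ k.
  rewrite -mulr_natr mulrC -ltr_pdivrMr //.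
  by apply: archi_boundP; exact: divr_ge0 b0 (ltW d0).
rewrite ltNge => /negP; apply; apply: le_trans (xb k).
by apply: le_trans (bern k); rewrite lerDr ler01.
Qed.

End AbsTheory.

HB.instance Definition _ (F : fieldType) (gT : finGroupType) (G : {group gT}) :=
  gen_eqMixin (representation F G).
HB.instance Definition _ (F : fieldType) (gT : finGroupType) (G : {group gT}) :=
  gen_choiceMixin (representation F G).

Section DirectSums.
Variables (F : fieldType) (gT : finGroupType) (G : {group gT}).
Implicit Types A B C D : representation F G.

Definition rsim A B : Prop := mx_rsim A B.

Local Notation "A (+) B" := (dadd_grepr A B) (at level 50, left associativity).
Local Notation "A ~~ B" := (rsim A B) (at level 70).

Lemma rsim_refl A : A ~~ A. Proof. exact: mx_rsim_refl. Qed.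
Lemma rsim_sym A B : A ~~ B -> B ~~ A. Proof. exact: mx_rsim_sym. Qed.
Lemma rsim_trans A B C : A ~~ B -> B ~~ C -> A ~~ C.
Proof. exact: mx_rsim_trans. Qed.

Lemma daddS_rsim A B C D : A ~~ B -> C ~~ D -> A (+) C ~~ B (+) D.
Proof.
move=> [P eP /row_freeP[P' PP'] hP] [Q eQ /row_freeP[Q' QQ'] hQ].
exists (block_mx P 0 0 Q) => [||x Gx] /=; first by rewrite eP eQ.
- apply/row_freeP; exists (block_mx P' 0 0 Q').
  by rewrite mulmx_block !(mulmx0, mul0mx, addr0, add0r) PP' QQ' -scalar_mx_block.
- by rewrite !mulmx_block !(mulmx0, mul0mx, addr0, add0r) hP // hQ.
Qed.

Lemma daddC_rsim A B : A (+) B ~~ B (+) A.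
Proof.
exists (block_mx 0 1%:M 1%:M 0) => [||x Gx] /=; first by rewrite addnC.
- apply/row_freeP; exists (block_mx 0 1%:M 1%:M 0).
  by rewrite mulmx_block !(mulmx0, mul0mx, mulmx1, addr0, add0r) -scalar_mx_block.
- by rewrite !mulmx_block !(mulmx0, mul0mx, mulmx1, mul1mx, addr0, add0r).
Qed.

Lemma cast_rsim A B (e : rdegree B = rdegree A) :
  (forall x, x \in G -> A x = castmx (e, e) (B x)) -> A ~~ B.
Proof.
case: A B e => n A [m B] /= e; case: n / e A => A AB.
apply: (@rsim_trans _ (Representation A)); first exact: rsim_refl.
exists 1%:M => // [|x Gx]; first by rewrite row_free_unit unitmx1.
by rewrite mulmx1 mul1mx AB // castmx_id.
Qed.

Lemma daddA_rsim A B C : A (+) (B (+) C) ~~ A (+) B (+) C.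
Proof.
apply: (@cast_rsim (A (+) (B (+) C)) (A (+) B (+) C) (esym (addnA _ _ _))).
move=> x Gx /=.
have := @block_mxA F _ _ _ _ _ _ (A x) 0 0 0 (B x) 0 0 0 (C x).
by rewrite /= !row_mx0 !col_mx0.
Qed.

Lemma dadd0_rsim A : grepr0 (+) A ~~ A.
Proof.
apply: (@cast_rsim (grepr0 (+) A) A erefl) => x Gx; rewrite castmx_id /=.
apply/matrixP => i j; rewrite mxE; case: splitP => [[]|i' ei] //; rewrite mxE.
by case: splitP => [[]|j' ej] //; congr (A x _ _); apply: val_inj.
Qed.

#[local] Instance rsim_equiv : Equivalence rsim.
Proof. by split; [exact: rsim_refl|exact: rsim_sym|exact: rsim_trans]. Qed.

#[local] Instance dadd_proper :
  Proper (rsim ==> rsim ==> rsim) (@dadd_grepr F gT G).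
Proof. by move=> A B AB C D CD; exact: daddS_rsim. Qed.

Lemma daddCA_rsim A B C : A (+) (B (+) C) ~~ B (+) (A (+) C).
Proof.
by rewrite daddA_rsim (daddC_rsim A B) -daddA_rsim; exact: rsim_refl.
Qed.

Lemma daddAC_rsim A B C : A (+) B (+) C ~~ A (+) C (+) B.
Proof. by rewrite -!daddA_rsim (daddC_rsim B C); exact: rsim_refl. Qed.

Lemma daddACA_rsim A B C D : (A (+) B) (+) (C (+) D) ~~ (A (+) C) (+) (B (+) D).
Proof.
by rewrite -!daddA_rsim (daddCA_rsim B C D); exact: rsim_refl.
Qed.

Lemma dadd_shuffle A B A1 B1 A2 B2 :
  ((A (+) B1) (+) A2) (+) ((A1 (+) B) (+) B2) ~~
  (A (+) B) (+) ((B1 (+) A2) (+) (A1 (+) B2)).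
Proof.
rewrite (daddACA_rsim A B) (daddA_rsim A B1 A2) (daddCA_rsim B A1 B2).
by rewrite (daddA_rsim A1 B B2); exact: rsim_refl.
Qed.

(* The pair (A, B) stands for [A] - [B]. *)
Definition K0_equiv (p q : representation F G * representation F G) : bool :=
  `[< exists C, rsim (dadd_grepr (dadd_grepr p.1 q.2) C)
                     (dadd_grepr (dadd_grepr q.1 p.2) C) >].

Lemma K0_equiv_refl : reflexive K0_equiv.
Proof. by move=> p; apply/asboolP; exists grepr0; exact: rsim_refl. Qed.

Lemma K0_equiv_sym : symmetric K0_equiv.
Proof.
by move=> p q; apply/asboolP/asboolP => -[C /rsim_sym h]; exists C.
Qed.

Lemma K0_equiv_trans : transitive K0_equiv.
Proof.
move=> [A' B'] [A B] [A2 B2] /asboolP[C /= h1] /asboolP[D /= h2].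
apply/asboolP; exists ((B' (+) C) (+) (A' (+) D)) => /=.
apply: rsim_trans (rsim_sym (dadd_shuffle _ _ _ _ _ _)) _.
apply: rsim_trans (daddS_rsim h1 h2) _.
apply: rsim_trans (dadd_shuffle _ _ _ _ _ _) _.
rewrite (daddACA_rsim B C) (daddACA_rsim B' C) (daddCA_rsim (A' (+) B')).
by rewrite (daddC_rsim B A2) (daddC_rsim B' A'); exact: rsim_refl.
Qed.

Canonical K0_equiv_rel :=
  EquivRel K0_equiv K0_equiv_refl K0_equiv_sym K0_equiv_trans.

(* In characteristic 0 the group algebra [F[G]] is semisimple: every exact
   sequence splits, so the relations coming from direct sums give the whole
   Grothendieck group of finite-dimensional representations. *)
Definition K0 : Type := {eq_quot K0_equiv}.

HB.instance Definition _ := Choice.on K0.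
HB.instance Definition _ := EqQuotient.on K0.

Definition K0_class A : K0 := \pi_K0 (A, grepr0).

Definition K0_zero : K0 := \pi_K0 (grepr0, grepr0).
Definition K0_add (x y : K0) : K0 :=
  \pi_K0 (dadd_grepr (repr x).1 (repr y).1, dadd_grepr (repr x).2 (repr y).2).
Definition K0_opp (x : K0) : K0 := \pi_K0 ((repr x).2, (repr x).1).

Lemma K0_eqP p q : reflect
  (exists C, (p.1 (+) q.2) (+) C ~~ (q.1 (+) p.2) (+) C)
  (\pi_K0 p == \pi_K0 q).
Proof. by rewrite eqmodE /=; exact: asboolP. Qed.

Lemma K0_addE A B C D : 
  K0_add (\pi_K0 (A, B)) (\pi_K0 (C, D)) = \pi_K0 (A (+) C, B (+) D).
Proof.
rewrite /K0_add.
case: piP => -[A1 B1] /eqP /K0_eqP /= [P hP].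
case: piP => -[C1 D1] /eqP /K0_eqP /= [Q hQ].
apply/eqP/K0_eqP; exists (P (+) Q) => /=.
rewrite (daddACA_rsim A1 C1) (daddACA_rsim (A1 (+) B)) (daddACA_rsim A C).
rewrite (daddACA_rsim (A (+) B1)).
by apply: daddS_rsim; exact: rsim_sym.
Qed.

Lemma K0_oppE A B : K0_opp (\pi_K0 (A, B)) = \pi_K0 (B, A).
Proof.
rewrite /K0_opp; case: piP => -[A1 B1] /eqP /K0_eqP /= [P hP].
apply/eqP/K0_eqP; exists P => /=.
by rewrite (daddC_rsim B1) (daddC_rsim B).
Qed.

Lemma K0_ind (P : K0 -> Prop) : (forall A B, P (\pi_K0 (A, B))) -> forall x, P x.
Proof. by move=> h x; rewrite -(reprK x); case: (repr x) => A B. Qed.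

Lemma K0_eq_rsim A B C D : A ~~ C -> B ~~ D -> \pi_K0 (A, B) = \pi_K0 (C, D).
Proof.
move=> AC BD; apply/eqP/K0_eqP; exists grepr0 => /=.
by rewrite AC BD; exact: rsim_refl.
Qed.

Lemma K0_addA : associative K0_add.
Proof.
elim/K0_ind=> A B; elim/K0_ind=> C D; elim/K0_ind=> A1 B1.
by rewrite !K0_addE; apply: K0_eq_rsim; exact: daddA_rsim.
Qed.

Lemma K0_addC : commutative K0_add.
Proof.
elim/K0_ind=> A B; elim/K0_ind=> C D.
by rewrite !K0_addE; apply: K0_eq_rsim; exact: daddC_rsim.
Qed.

Lemma K0_add0 : left_id K0_zero K0_add.
Proof.
elim/K0_ind=> A B; rewrite K0_addE; apply: K0_eq_rsim; exact: dadd0_rsim.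
Qed.

Lemma K0_addN : left_inverse K0_zero K0_opp K0_add.
Proof.
elim/K0_ind=> A B; rewrite K0_oppE K0_addE; apply/eqP/K0_eqP.
exists grepr0 => /=; rewrite (daddC_rsim B A) (daddC_rsim grepr0).
exact: rsim_refl.
Qed.

HB.instance Definition _ :=
  GRing.isZmodule.Build K0 K0_addA K0_addC K0_add0 K0_addN.

Lemma K0_class_dadd A B : K0_class (A (+) B) = K0_class A + K0_class B.
Proof.
rewrite [RHS]K0_addE; apply: K0_eq_rsim; first exact: rsim_refl.
exact: rsim_sym (dadd0_rsim _).
Qed.

Lemma K0_piE A B : \pi_K0 (A, B) = K0_class A - K0_class B.
Proof.
rewrite [- _]K0_oppE [RHS]K0_addE; apply: K0_eq_rsim.
  by rewrite (daddC_rsim A); exact: rsim_sym (dadd0_rsim _).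
exact: rsim_sym (dadd0_rsim _).
Qed.

Lemma K0_class_rsim A B : A ~~ B -> K0_class A = K0_class B.
Proof. by move=> AB; apply: K0_eq_rsim => //; exact: rsim_refl. Qed.

Lemma K0_gen (P : K0 -> Prop) :
  (forall A B, P (K0_class A - K0_class B)) -> forall x, P x.
Proof. by move=> h; elim/K0_ind=> A B; rewrite K0_piE. Qed.

End DirectSums.

Arguments K0 F {gT} G.
Arguments K0_class {F gT G} A.

Section K0Lift.
Variables (F : fieldType) (gT : finGroupType) (G : {group gT}).

(* Universal property of [K0], written for multiplicative maps to the units of
   a field. *)
Variables (L : fieldType) (d : representation F G -> L).
Hypothesis d_rsim : forall A B, rsim A B -> d A = d B.
Hypothesis d_dadd : forall A B, d (dadd_grepr A B) = d A * d B.
Hypothesis d_neq0 : forall A, d A != 0.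

Definition K0_lift (x : K0 F G) : L := d (repr x).1 / d (repr x).2.

Lemma K0_lift_pi A B : K0_lift (\pi_(K0 F G) (A, B)) = d A / d B.
Proof.
rewrite /K0_lift; case: piP => -[A1 B1] /eqP /K0_eqP /= [C /d_rsim].
rewrite !d_dadd => /(mulIf (d_neq0 _)) h.
by apply/eqP; rewrite eqr_div // -h.
Qed.

Lemma d_grepr0 : d grepr0 = 1.
Proof.
apply: (mulIf (d_neq0 grepr0)); rewrite -d_dadd mul1r.
exact/d_rsim/dadd0_rsim.
Qed.

Lemma K0_lift_class A : K0_lift (K0_class A) = d A.
Proof. by rewrite K0_lift_pi d_grepr0 divr1. Qed.

Lemma K0_liftD x y : K0_lift (x + y) = K0_lift x * K0_lift y.
Proof.
elim/K0_ind: x => A B; elim/K0_ind: y => C D.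
by rewrite [_ + _]K0_addE !K0_lift_pi !d_dadd -mulf_div.
Qed.

End K0Lift.

Section K0Map.
Variables (F : fieldType) (gT : finGroupType) (G : {group gT}).
Variable s : {rmorphism F -> F}.

Definition grepr_map (A : representation F G) : representation F G :=
  Representation (map_repr s A).

Lemma grepr_map_rsim A B : rsim A B -> rsim (grepr_map A) (grepr_map B).
Proof. exact: mx_rsim_map. Qed.

Lemma grepr_map_dadd A B :
  rsim (grepr_map (dadd_grepr A B)) (dadd_grepr (grepr_map A) (grepr_map B)).
Proof.
apply: (@cast_rsim _ _ _ (grepr_map (dadd_grepr A B))
  (dadd_grepr (grepr_map A) (grepr_map B)) erefl) => x Gx.
by rewrite castmx_id /= /map_repr_mx /= map_block_mx !map_mx0.
Qed.

Definition K0_map (x : K0 F G) : K0 F G :=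
  K0_class (grepr_map (repr x).1) - K0_class (grepr_map (repr x).2).

Lemma K0_map_pi A B : K0_map (\pi_(K0 F G) (A, B)) =
  K0_class (grepr_map A) - K0_class (grepr_map B).
Proof.
rewrite /K0_map; case: piP => -[A1 B1] /eqP /K0_eqP /= [C].
move/grepr_map_rsim/K0_class_rsim.
rewrite !(K0_class_rsim (grepr_map_dadd _ _)) !K0_class_dadd.
rewrite !(K0_class_rsim (grepr_map_dadd _ _)) !K0_class_dadd.
move/addIr => h; apply/eqP; rewrite subr_eq addrAC eq_sym subr_eq.
by rewrite h.
Qed.

Lemma K0_map_class A : K0_map (K0_class A) = K0_class (grepr_map A).
Proof.
rewrite K0_map_pi; suff -> : K0_class (grepr_map grepr0) = 0 by rewrite subr0.
apply: K0_class_rsim; apply: (@cast_rsim _ _ _ (grepr_map grepr0) grepr0 erefl).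
by move=> x Gx; apply/matrixP => -[].
Qed.

Lemma K0_mapD x y : K0_map (x + y) = K0_map x + K0_map y.
Proof.
elim/K0_ind: x => A B; elim/K0_ind: y => C D.
rewrite [_ + _ in LHS]K0_addE !K0_map_pi.
rewrite !(K0_class_rsim (grepr_map_dadd _ _)) !K0_class_dadd.
by rewrite opprD addrACA.
Qed.

End K0Map.

Section Determinants.
Variables (R : realType) (F : fieldType) (N : splittingFieldType F).
Variables (a : nonarch_abs R N) (gT : finGroupType) (G : {group gT}).
Implicit Types (E K M : {subfield N}) (s t : gal_of {:N}).

Definition K0_gal s : K0 N G -> K0 N G := K0_map (gal_repr s : {rmorphism N -> N}).

(* Hom_{Gal(N/E)}(R(G), O_N^* ): the source is additive, the target is
   multiplicative. *)

Definition gal_hom_spec E (f : K0 N G -> N) : Prop :=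
  [/\ forall x, f x \in val_ring_unit a {:N},
      forall x y, f (x + y) = f x * f y
    & forall s, s \in 'Gal({:N} / E)%g -> forall x, f (K0_gal s x) = s (f x)].

Record gal_hom E := GalHom {
  gal_hom_fun :> K0 N G -> N;
  gal_homP : `[< gal_hom_spec E gal_hom_fun >]
}.

HB.instance Definition _ E := [isSub for @gal_hom_fun E].
HB.instance Definition _ E := [Choice of gal_hom E by <:].

Lemma val_ring_unitP x : reflect (a x = 1) (x \in val_ring_unit a {:N}).
Proof.
rewrite !inE !memvf /= absV; apply: (iffP idP) => [/and3P[x0 x1 xV1]|x1].
  apply/eqP; rewrite eq_le x1 /=; rewrite invf_le1 // in xV1.
  by rewrite lt0r abs_eq0 x0 abs_ge0.
by rewrite -(abs_eq0 a) x1 invr1 oner_eq0 lexx.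
Qed.

Section GalHomGroup.
Variable E : {subfield N}.

Lemma gal_hom_unit (f : gal_hom E) x : f x \in val_ring_unit a {:N}.
Proof. by case/asboolP: (gal_homP f). Qed.

Lemma gal_hom_neq0 (f : gal_hom E) x : f x != 0.
Proof. by have /and3P[] := gal_hom_unit f x. Qed.

Lemma gal_homD (f : gal_hom E) x y : f (x + y) = f x * f y.
Proof. by case/asboolP: (gal_homP f). Qed.

Lemma gal_hom_gal (f : gal_hom E) s x :
  s \in 'Gal({:N} / E)%g -> f (K0_gal s x) = s (f x).
Proof. by case/asboolP: (gal_homP f) => _ _ h /h. Qed.

Fact gal_hom1_subproof : `[< gal_hom_spec E (fun=> 1) >].
Proof.
apply/asboolP; split=> [x|x y|s _ x]; first by apply/val_ring_unitP/abs1.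
- by rewrite mulr1.
- by rewrite rmorph1.
Qed.

Fact gal_homM_subproof (f g : gal_hom E) :
  `[< gal_hom_spec E (fun x => f x * g x) >].
Proof.
apply/asboolP; split=> [x|x y|s sE x].
- apply/val_ring_unitP; rewrite absM.
  by do 2!rewrite (val_ring_unitP _ (gal_hom_unit _ _)); rewrite mulr1.
- by rewrite !gal_homD mulrACA.
- by rewrite !gal_hom_gal // rmorphM.
Qed.

Fact gal_homV_subproof (f : gal_hom E) : `[< gal_hom_spec E (fun x => (f x)^-1) >].
Proof.
apply/asboolP; split=> [x|x y|s sE x].
- apply/val_ring_unitP; rewrite absV.
  by rewrite (val_ring_unitP _ (gal_hom_unit _ _)) invr1.
- by rewrite !gal_homD invfM.
- by rewrite !gal_hom_gal // fmorphV.
Qed.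

Definition gal_hom_one := GalHom gal_hom1_subproof.
Definition gal_hom_mul f g := GalHom (gal_homM_subproof f g).
Definition gal_hom_inv f := GalHom (gal_homV_subproof f).

Lemma gal_hom_eq (f g : gal_hom E) : f =1 g -> f = g.
Proof. by move=> fg; apply/val_inj/funext. Qed.

Fact gal_hom_mulA : associative gal_hom_mul.
Proof. by move=> f g h; apply: gal_hom_eq => x /=; rewrite mulrA. Qed.
Fact gal_hom_mul1g : left_id gal_hom_one gal_hom_mul.
Proof. by move=> f; apply: gal_hom_eq => x /=; rewrite mul1r. Qed.
Fact gal_hom_mulg1 : right_id gal_hom_one gal_hom_mul.
Proof. by move=> f; apply: gal_hom_eq => x /=; rewrite mulr1. Qed.
Fact gal_hom_mulVg : left_inverse gal_hom_one gal_hom_inv gal_hom_mul.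
Proof.
by move=> f; apply: gal_hom_eq => x /=; rewrite mulVf ?gal_hom_neq0.
Qed.
Fact gal_hom_mulgV : right_inverse gal_hom_one gal_hom_inv gal_hom_mul.
Proof.
by move=> f; apply: gal_hom_eq => x /=; rewrite divff ?gal_hom_neq0.
Qed.

HB.instance Definition _ := isGroup.Build (gal_hom E) gal_hom_mulA
  gal_hom_mul1g gal_hom_mulg1 gal_hom_mulVg gal_hom_mulgV.

End GalHomGroup.

(* N[G] is realized by the matrices of the regular representation, as in
   [group_ring]; [int_gring E] is O_E[G] and [int_gring_unit E] is O_E[G]^*. *)

Definition int_gring E (u : 'M[N]_#|G|) : Prop :=
  exists2 l : gT -> N, forall g, l g \in val_ring a E
  & u = \sum_(g in G) l g *: regular_repr N G g.

Definition int_gring_unit_spec E (u : 'M[N]_#|G|) : Prop :=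
  int_gring E u /\
  exists2 v, int_gring E v & u *m v = 1%:M /\ v *m u = 1%:M.

Record int_gring_unit E := IntGringUnit {
  gring_unit_val :> 'M[N]_#|G|;
  gring_unitP : `[< int_gring_unit_spec E gring_unit_val >]
}.

HB.instance Definition _ E := [isSub for @gring_unit_val E].
HB.instance Definition _ E := [Choice of int_gring_unit E by <:].

Section IntGringUnit.
Variable E : {subfield N}.

Lemma val_ring0 : 0 \in val_ring a E.
Proof. by rewrite inE mem0v /= abs0 ler01. Qed.

Lemma val_ring1 : 1 \in val_ring a E.
Proof. by rewrite inE mem1v /= abs1. Qed.

Lemma val_ringM x y :
  x \in val_ring a E -> y \in val_ring a E -> x * y \in val_ring a E.
Proof.
rewrite !inE => /andP[Ex x1] /andP[Ey y1].
by rewrite memvM //= absM mulr_ile1 ?abs_ge0.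
Qed.

Lemma val_ring_sum (I : Type) (r : seq I) (P : pred I) (f : I -> N) :
  (forall i, P i -> f i \in val_ring a E) ->
  \sum_(i <- r | P i) f i \in val_ring a E.
Proof.
move=> fE; rewrite inE memv_suml => [|i /fE/andP[]//].
by apply: abs_sum_le => // i /fE/andP[].
Qed.

Lemma int_gring1 : int_gring E 1%:M.
Proof.
exists (fun g => (g == 1%g)%:R) => [g|].
  by case: eqP => _; [exact: val_ring1 | exact: val_ring0].
rewrite (bigD1 1%g) //= eqxx scale1r repr_mx1 big1 ?addr0 // => g /andP[_ ].
by move/negPf->; rewrite scale0r.
Qed.

Lemma int_gringM u v : int_gring E u -> int_gring E v -> int_gring E (u *m v).
Proof.
move=> [l lE ->] [m mE ->].
exists (fun g => \sum_(h in G) l h * m (h^-1 * g)%g) => [g|].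
  by apply: val_ring_sum => h _; exact: val_ringM.
rewrite mulmx_suml; under [RHS]eq_bigr do rewrite scaler_suml.
rewrite exchange_big /=; apply: eq_bigr => h Gh.
rewrite mulmx_sumr [RHS](reindex_inj (mulgI h)) /=.
apply: eq_big => [g|g Gg]; first by rewrite groupMl.
by rewrite -scalemxAl -scalemxAr scalerA repr_mxM // mulKg.
Qed.

Lemma int_gring_mem u : int_gring E u -> (u \in group_ring N G)%MS.
Proof.
move=> [l _ ->]; rewrite linear_sum summx_sub // => g Gg.
by rewrite linearZ scalemx_sub // envelop_mx_id.
Qed.

Fact gring_unit1_subproof : `[< int_gring_unit_spec E 1%:M >].
Proof.
apply/asboolP; split; first exact: int_gring1.
by exists 1%:M; [exact: int_gring1 | rewrite mulmx1].
Qed.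

Fact gring_unitM_subproof (u v : int_gring_unit E) :
  `[< int_gring_unit_spec E (u *m v) >].
Proof.
case/asboolP: (gring_unitP u) => uE [u' u'E [uu' u'u]].
case/asboolP: (gring_unitP v) => vE [v' v'E [vv' v'v]].
apply/asboolP; split; first exact: int_gringM.
exists (v' *m u'); first exact: int_gringM.
split; first by rewrite mulmxA -(mulmxA _ _ v') vv' mulmx1.
by rewrite mulmxA -(mulmxA _ u') u'u mulmx1.
Qed.

Lemma gring_unit_unitmx (u : int_gring_unit E) : (u : 'M_#|G|) \in unitmx.
Proof.
case/asboolP: (gring_unitP u) => _ [v _ [uv _]].
by case: (mulmx1_unit uv).
Qed.

Fact gring_unitV_subproof (u : int_gring_unit E) :
  `[< int_gring_unit_spec E (invmx u) >].
Proof.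
have Uu := gring_unit_unitmx u; apply/asboolP.
case/asboolP: (gring_unitP u) => uE [v vE [uv _]].
have <- : v = invmx u by rewrite -[v](mulKmx Uu) uv mulmx1.
split=> //; exists u => //; split=> //.
by rewrite -[v](mulKmx Uu) uv mulmx1 mulVmx.
Qed.

Definition gring_unit_one := IntGringUnit gring_unit1_subproof.
Definition gring_unit_mul u v := IntGringUnit (gring_unitM_subproof u v).
Definition gring_unit_inv u := IntGringUnit (gring_unitV_subproof u).

Fact gring_unit_mulA : associative gring_unit_mul.
Proof. by move=> u v w; apply: val_inj => /=; rewrite mulmxA. Qed.
Fact gring_unit_mul1g : left_id gring_unit_one gring_unit_mul.
Proof. by move=> u; apply: val_inj => /=; rewrite mul1mx. Qed.
Fact gring_unit_mulg1 : right_id gring_unit_one gring_unit_mul.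
Proof. by move=> u; apply: val_inj => /=; rewrite mulmx1. Qed.
Fact gring_unit_mulVg : left_inverse gring_unit_one gring_unit_inv gring_unit_mul.
Proof.
by move=> u; apply: val_inj => /=; rewrite mulVmx ?gring_unit_unitmx.
Qed.
Fact gring_unit_mulgV : right_inverse gring_unit_one gring_unit_inv gring_unit_mul.
Proof.
by move=> u; apply: val_inj => /=; rewrite mulmxV ?gring_unit_unitmx.
Qed.

HB.instance Definition _ := isGroup.Build (int_gring_unit E) gring_unit_mulA
  gring_unit_mul1g gring_unit_mulg1 gring_unit_mulVg gring_unit_mulgV.

End IntGringUnit.

Section Det.
Variable E : {subfield N}.
Implicit Types (u v : int_gring_unit E) (A B : representation N G).

(* [gring_op A] is the linear extension of [A] to the group ring. *)
Definition det_repr (u : 'M[N]_#|G|) A : N := \det (gring_op A u).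

Lemma det_reprE (l : gT -> N) A :
  det_repr (\sum_(g in G) l g *: regular_repr N G g) A =
  \det (\sum_(g in G) l g *: A g).
Proof.
rewrite /det_repr linear_sum; congr (\det _); apply: eq_bigr => g Gg.
by rewrite linearZ /= gring_opG.
Qed.

Lemma det_reprM (u v : 'M[N]_#|G|) A : (v \in group_ring N G)%MS ->
  det_repr (u *m v) A = det_repr u A * det_repr v A.
Proof. by move=> v_in; rewrite /det_repr gring_opM // det_mulmx. Qed.

Lemma det_repr1 A : det_repr 1%:M A = 1.
Proof. by rewrite /det_repr gring_op1 det1. Qed.

Lemma gring_unit_int u : int_gring E u.
Proof. by case/asboolP: (gring_unitP u). Qed.

Lemma det_repr_rsim u A B : rsim A B -> det_repr u A = det_repr u B.
Proof.
case: (gring_unit_int u) => l _ ->; rewrite !det_reprE.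
case: A B => n A [m B] [/= P nm]; case: m / nm B P => B P.
rewrite row_free_unit => Pu hP.
have -> : \sum_(g in G) l g *: A g = P *m (\sum_(g in G) l g *: B g) *m invmx P.
  rewrite mulmx_sumr mulmx_suml; apply: eq_bigr => g Gg.
  by rewrite -scalemxAr -scalemxAl -hP // mulmxK.
by rewrite !det_mulmx mulrAC -det_mulmx mulmxV // det1 mul1r.
Qed.

Lemma det_repr_dadd u A B :
  det_repr u (dadd_grepr A B) = det_repr u A * det_repr u B.
Proof.
case: (gring_unit_int u) => l _ ->; rewrite !det_reprE -(@det_ublock _ _ _ _ 0).
congr (\det _) => /=.
elim/big_rec3: _ => [|g X Y Z _ ->]; first by rewrite [RHS]block_mx_const.
by rewrite scale_block_mx add_block_mx !scaler0 !addr0.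
Qed.

Lemma int_gring_exp (u : 'M[N]_#|G|) k : int_gring E u ->
  exists2 v, int_gring E v & forall A, det_repr v A = det_repr u A ^+ k.
Proof.
move=> uE; elim: k => [|k [v vE IH]].
  by exists 1%:M => [|A]; [exact: int_gring1 | rewrite det_repr1].
exists (v *m u) => [|A]; first exact: int_gringM.
by rewrite det_reprM ?(int_gring_mem uE) // IH exprSr.
Qed.

Lemma det_repr_le1 (u : 'M[N]_#|G|) A : int_gring E u -> a (det_repr u A) <= 1.
Proof.
move=> uE.
pose b : R := \sum_(g in G) \sum_i \sum_j a (A g i j).
have b0 : 0 <= b.
  by do 3!apply: sumr_ge0 => ? _; exact: abs_ge0.
apply: (@bounded_powers_le1 R _ (b ^+ rdegree A)) => k; rewrite -absX.
have [v [l lE ->] <-] := int_gring_exp k uE; rewrite det_reprE.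
apply: abs_det_le => // i j; rewrite summxE; apply: abs_sum_le => // g Gg.
rewrite mxE absM -[b]mul1r.
have /andP[_ l1] := lE g.
apply: ler_pM; rewrite ?abs_ge0 //.
rewrite /b (bigD1 g) //= (bigD1 i) //= (bigD1 j) //= -!addrA lerDl.
rewrite !addr_ge0 ?sumr_ge0 // => *; rewrite ?sumr_ge0 // => *.
all: rewrite ?sumr_ge0 // => *; exact: abs_ge0.
Qed.

Lemma det_repr_unit u A : det_repr u A \in val_ring_unit a {:N}.
Proof.
apply/val_ring_unitP; case/asboolP: (gring_unitP u) => uE [v vE [uv _]].
apply/eqP; rewrite eq_le det_repr_le1 //=.
have := abs1 a; rewrite -(det_repr1 A) -uv det_reprM ?(int_gring_mem vE) //.
rewrite absM => <-; rewrite ler_piMr ?abs_ge0 //; exact: det_repr_le1.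
Qed.

Lemma det_repr_neq0 u A : det_repr u A != 0.
Proof. by have /and3P[] := det_repr_unit u A. Qed.

Lemma det_repr_gal u s A : s \in 'Gal({:N} / E)%g ->
  det_repr u (grepr_map (gal_repr s : {rmorphism N -> N}) A) = s (det_repr u A).
Proof.
move=> sE; case: (gring_unit_int u) => l lE ->; rewrite !det_reprE.
rewrite -[RHS]det_map_mx map_mx_sum; congr (\det _); apply: eq_bigr => g Gg.
have /andP[Elg _] := lE g.
by rewrite map_mxZ /= (fixed_gal _ sE) ?subvf.
Qed.

Definition Det_fun u : K0 N G -> N := K0_lift (det_repr u).

Fact Det_subproof u : `[< gal_hom_spec E (Det_fun u) >].
Proof.
have rs := @det_repr_rsim u; have dd := det_repr_dadd u.
have n0 := det_repr_neq0 u.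
apply/asboolP; split=> [x|x y|s sE x]; last 2 first.
- exact: K0_liftD.
- elim/K0_ind: x => A B; rewrite /K0_gal K0_map_pi -K0_piE.
  by rewrite /Det_fun !K0_lift_pi // !det_repr_gal // fmorph_div.
elim/K0_ind: x => A B; rewrite /Det_fun K0_lift_pi //.
apply/val_ring_unitP; rewrite absM absV.
by do 2!rewrite (val_ring_unitP _ (det_repr_unit _ _)); rewrite divr1.
Qed.

Definition Det u : gal_hom E := GalHom (Det_subproof u).

Lemma DetE u (l : gT -> N) A :
  (u : 'M_#|G|) = \sum_(g in G) l g *: regular_repr N G g ->
  Det u (K0_class A) = \det (\sum_(g in G) l g *: A g).
Proof.
move=> ul; rewrite -det_reprE -ul; apply: K0_lift_class.
- exact: det_repr_rsim.
- exact: det_repr_dadd.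
- exact: det_repr_neq0.
Qed.

Fact Det_multiplicative : {morph Det : u v / (u * v)%g}.
Proof.
move=> u v; apply: gal_hom_eq; elim/K0_ind=> A B /=.
have n0 w := det_repr_neq0 w.
rewrite /Det_fun !K0_lift_pi //; 
  do ?[exact: det_repr_rsim|exact: det_repr_dadd].
by rewrite !det_reprM ?(int_gring_mem (gring_unit_int v)) // mulf_div.
Qed.

HB.instance Definition _ :=
  isMultiplicative.Build (int_gring_unit E) (gal_hom E) Det Det_multiplicative.

End Det.

Definition Det_image E : {pred gal_hom E} :=
  [pred f | `[< exists u : int_gring_unit E, Det u = f >]].

Record det_group E := DetGroup {
  det_group_val :> gal_hom E;
  det_groupP : det_group_val \in @Det_image E
}.

HB.instance Definition _ E := [isSub for @det_group_val E].
HB.instance Definition _ E := [Choice of det_group E by <:].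

Fact Det_image_group_closed E : group_closed (@Det_image E).
Proof.
split=> [|_ _ /asboolP[u <-] /asboolP[v <-]]; apply/asboolP.
  exists 1%g; apply: (mulgI (Det 1%g)).
  by rewrite mulg1 -Det_multiplicative mulg1.
exists (u * v^-1)%g; apply: (mulIg (Det v)).
by rewrite -Det_multiplicative !mulgKV.
Qed.

HB.instance Definition _ E :=
  SubChoice_isSubGroup.Build (gal_hom E) (@Det_image E) (det_group E)
    (@Det_image_group_closed E).

Definition gal_act t (f : K0 N G -> N) : K0 N G -> N :=
  fun x => t (f (K0_gal t^-1%g x)).

(* [t] is a lift to N of [s] in Gal(M/K). All lifts act in the same way on
   Hom_{Gal(N/M)}(R(G), O_N^* ). *)
Definition Gal_fixed K M : {pred det_group M} :=
  [pred f : det_group M | `[< forall s : gal_of M, s \in 'Gal(M / K)%g ->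
                forall t, t \in 'Gal({:N} / K)%g -> {in M, t =1 s} ->
                gal_act t f =1 f >]].

Record det_invariants K M := DetInvariants {
  det_invariants_val :> det_group M;
  det_invariantsP : det_invariants_val \in @Gal_fixed K M
}.

HB.instance Definition _ K M := [isSub for @det_invariants_val K M].
HB.instance Definition _ K M := [Choice of det_invariants K M by <:].

Fact Gal_fixed_group_closed K M : group_closed (@Gal_fixed K M).
Proof.
split=> [|f g /asboolP fix_f /asboolP fix_g]; apply/asboolP => s sM t tK ts x.
  by rewrite /gal_act /= rmorph1.
have := fix_f s sM t tK ts x; have := fix_g s sM t tK ts x.
by rewrite /gal_act /= rmorphM fmorphV /= => -> ->.
Qed.

HB.instance Definition _ K M :=
  SubChoice_isSubGroup.Build (det_group M) (@Gal_fixed K M) (det_invariants K M)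
    (@Gal_fixed_group_closed K M).

End Determinants.

Arguments gal_hom {R F N} a {gT} G E.
Arguments int_gring_unit {R F N} a {gT} G E.
Arguments det_group {R F N} a {gT} G E.
Arguments det_invariants {R F N} a {gT} G K M.

(* Main.v *)
(* The irreducible representations of G with z = 1 have degree 1; those with
   z = -1 all have the same degree 2^m, m > 0, and are described by a central
   character psi on Z = Z(G). Let f = Det u be invariant. On the representations
   of degree 1 it determines the image of u in O_M[G/<z>], which is therefore
   invariant and lifts to a unit of O_K[G]; dividing by this lift reduces the
   problem to u = 1 + (1 - z) x, for which f is trivial where z = 1 and equals
   det (1 + 2 x) where z = -1.

   There the values on 1 + (1 - z) O_E[G] are exactly the functions
   1 + 2^(m+1) psi(c) with c in O_E[Z], for every E, and an invariant function
   of this form over M is one over K. That every value has this form follows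
   from Newton's identities, since the trace vanishes off Z. Conversely the
   elements 1 + (1 - z) c with c in O_E[Z] or c = b g, g noncentral, have
   determinants (1 + 4 psi(c + c^2))^(2^(m-1)) and
   (1 - 4 b^2 psi(g^2))^(2^(m-1)). Hensel's lemma reduces the claim that they
   generate (1 + 4 psi(O_E[Z]))^(2^(m-1)) to additive generation modulo the
   maximal ideal, where every scalar is a square: call y in Z good if all
   multiples of y are obtained. Squares of noncentral elements are good, and
   c y + c^2 y^2 is obtained, so y is good if and only if y^2 is; as Z is a
   2-group, going up from a good element to 1 and down again, all of Z is
   good. *)

Require Import Defs.
From HB Require Import structures.
From mathcomp Require Import all_boot all_order all_algebra all_fingroup.
From mathcomp Require Import all_solvable all_field all_character.
From mathcomp Require Import generic_quotient boolp reals.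
From mathcomp Require Import ring zify.

Set Implicit Arguments.
Unset Strict Implicit.
Unset Printing Implicit Defensive.

Import Order.TTheory GRing.Theory Num.Theory.

Local Open Scope ring_scope.

(** * Newton's identities *)

Section Newton.

Lemma deriv_prod (A : comNzRingType) (I : finType) (f : I -> {poly A}) :
  (\prod_i f i)^`() = \sum_j (f j)^`() * \prod_(i | i != j) f i.
Proof.
suff H (s : seq I) : uniq s -> (\prod_(i <- s) f i)^`() =
    \sum_(j <- s) (f j)^`() * \prod_(i <- s | i != j) f i.
  by rewrite H ?index_enum_uniq.
elim: s => [|x s IH] /=; first by rewrite !big_nil -polyC1 derivC.
case/andP=> xs us; rewrite !big_cons derivM IH // eqxx /= mulr_sumr.
congr (_ * _ + _).
  rewrite big_seq_cond [RHS]big_seq_cond; apply: eq_bigl => i.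
  by case: eqP => [->|]; rewrite ?(negPf xs) // andbT.
rewrite !big_seq; apply: eq_bigr => j js; rewrite big_cons.
have -> : x != j by apply: contraNneq xs => ->.
by rewrite mulrCA.
Qed.

(** Jacobi's formula. Differentiating the Leibniz expansion gives one determinant per row, with that
    row differentiated; expanding it along this row leaves the cofactors of [B]. *)
Lemma deriv_det (A : comNzRingType) n (B : 'M[{poly A}]_n) :
  (\det B)^`() = \tr (map_mx (@deriv A) B *m \adj B).
Proof.
rewrite linear_sum /=.
under eq_bigr => s _.
  have -> : ((-1) ^+ s * \prod_i B i (s i))^`() =
      (-1) ^+ s * (\prod_i B i (s i))^`().
    by case: (s : bool); rewrite ?expr1 ?expr0 ?mul1r // !mulN1r derivN.
  rewrite deriv_prod mulr_sumr; over.
rewrite exchange_big /=; apply: eq_bigr => j _; rewrite mxE.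
pose C := \matrix_(i, k) if i == j then (B i k)^`() else B i k.
have <- : \det C = \sum_k map_mx (@deriv A) B j k * \adj B k j.
  rewrite (expand_det_row C j); apply: eq_bigr => k _; rewrite !mxE eqxx.
  congr (_ * (_ * \det _)); apply/matrixP => p q; rewrite !mxE.
  by rewrite eq_sym (negPf (neq_lift _ _)).
apply: eq_bigr => s _; congr (_ * _); rewrite [RHS](bigD1 j) //= mxE eqxx.
by congr (_ * _); apply: eq_bigr => i ij; rewrite mxE (negPf ij).
Qed.

Variables (F : fieldType) (n : nat) (W : 'M[F]_n).

(** The coefficient of ['X^k] is the k-th elementary symmetric function of the eigenvalues of
    [W]. *)
Definition det_pencil : {poly F} := \det (1%:M + 'X *: map_mx polyC W).

Lemma horner_det_pencil x : det_pencil.[x] = \det (1%:M + x *: W).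
Proof.
rewrite -horner_evalE -det_map_mx; congr (\det _).
apply/matrixP => i j; rewrite !mxE /= /horner_eval hornerD hornerM hornerX hornerC.
by rewrite hornerMn hornerC.
Qed.

Lemma size_det_pencil : (size det_pencil <= n.+1)%N.
Proof.
apply: (leq_trans (size_sum _ _ _)); apply/bigmax_leqP => s _.
have -> : (-1) ^+ s = ((-1) ^+ s : F)%:P by rewrite rmorphXn rmorphN1.
rewrite mul_polyC; apply: (leq_trans (size_scale_leq _ _)).
apply: (leq_trans (size_prod_leq _ _)).
rewrite leq_subLR cardT size_enum_ord addnS ltnS.
apply: (@leq_trans (\sum_(i < n) 2)%N); last first.
  by rewrite sum_nat_const card_ord muln2 addnn.
apply: leq_sum => i _; rewrite !mxE.
apply: (leq_trans (size_polyD _ _)); rewrite geq_max; apply/andP; split.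
  case: eqP => _; rewrite ?mulr0n ?size_poly0 // mulr1n size_poly1 //.
by rewrite mulrC (leq_trans (size_polyMleq _ _)) // size_polyX addn2 /= ltnS size_polyC_leq1.
Qed.

(* Jacobi's formula gives [P' = tr (W Q)] for the adjugate [Q] of [1 + tW], and
   [Q = P - t W Q] expands the trace in powers of [t]. *)
Lemma newton_identity k :
  det_pencil`_k.+1 *+ k.+1 =
  \sum_(i < k.+1) (-1) ^+ i * \tr (iter i (mulmx W) W) * det_pencil`_(k - i).
Proof.
pose V := map_mx polyC W; pose B := 1%:M + 'X *: V; pose Q := \adj B.
pose P := det_pencil.
have QE : Q = P%:M - 'X *: (V *m Q).
  have : B *m Q = P%:M by rewrite mul_mx_adj.
  by rewrite mulmxDl mul1mx -scalemxAl => <-; rewrite addrK.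
pose Wi i := iter i (mulmx W) W.
have trQ i : \tr (map_mx polyC (Wi i) *m Q) =
    (\tr (Wi i))%:P * P - 'X * \tr (map_mx polyC (Wi i.+1) *m Q).
  rewrite {1}QE mulmxBr -scalemx1 -scalemxAr mulmx1 linearB linearZ /= mulrC.
    rewrite -trace_map_mx; congr (_ - _).
  have comm : Wi i *m W = Wi i.+1.
    by rewrite /Wi; elim: i => //= i IH; rewrite -mulmxA IH.
  by rewrite -scalemxAr linearZ /= mulmxA -map_mxM comm.
(* Unrolling [trQ] [K] times leaves a remainder divisible by ['X^K]. With [K = k.+1] it does not
   reach the coefficient of index [k]. *)
have step K : P^`() = \sum_(i < K) (-1) ^+ i * (\tr (Wi i))%:P * P * 'X^i +
    (-1) ^+ K * 'X^K * \tr (map_mx polyC (Wi K) *m Q).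
  elim: K => [|K ->].
    rewrite big_ord0 add0r !expr0 !mul1r /P /det_pencil deriv_det -/Q.
    congr (\tr (_ *m _)); apply/matrixP => p q; rewrite !mxE.
    rewrite derivD derivM derivX mul1r derivC mulr0 addr0.
    by rewrite -raddfMn derivC add0r.
  rewrite big_ord_recr /= trQ -addrA; congr (_ + _).
  rewrite mulrBr !exprS mulN1r !mulNr; congr (_ - _).
    by rewrite -!mulrA; congr (_ * _); rewrite mulrC -mulrA.
  by rewrite ['X * 'X^K]mulrC -!mulrA.
have := congr1 (fun p : {poly F} => p`_k) (step k.+1).
rewrite coef_deriv => ->; rewrite coefD coef_sum [X in _ + X](_ : _ = 0).
  rewrite addr0; apply: eq_bigr => i _.
  have -> : (-1) ^+ i = ((-1) ^+ i : F)%:P by rewrite rmorphXn rmorphN1.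
  by rewrite -polyCM coefMXn ltnNge -ltnS ltn_ord /= coefCM.
by rewrite mulrAC coefMXn ltnSn.
Qed.

End Newton.

(** * Ultrametric fields and completeness *)

Section Ultrametric.

Variables (R : realType) (F : fieldType) (a : nonarch_abs R F).

Lemma absD_lt x y e : a x < e -> a y < e -> a (x + y) < e.
Proof. by move=> xe ye; apply: le_lt_trans (absD _ _ _) _; rewrite gt_max xe. Qed.

Lemma absD_le x y e : a x <= e -> a y <= e -> a (x + y) <= e.
Proof. by move=> xe ye; apply: le_trans (absD _ _ _) _; rewrite ge_max xe. Qed.

Lemma absB_lt x y e : a x < e -> a y < e -> a (x - y) < e.
Proof. by move=> xe ye; apply: absD_lt; rewrite ?absN. Qed.

Lemma absB_le x y e : a x <= e -> a y <= e -> a (x - y) <= e.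
Proof. by move=> xe ye; apply: absD_le; rewrite ?absN. Qed.

Lemma abs_distC x y : a (x - y) = a (y - x).
Proof. by rewrite -absN opprB. Qed.

Lemma abs_eq1 x y : a x = 1 -> a (x - y) < 1 -> a y = 1.
Proof.
move=> x1 xy; apply/eqP; rewrite eq_le; apply/andP; split.
  have -> : y = x - (x - y) by rewrite subKr.
  by apply: absB_le; rewrite ?x1 // ltW.
rewrite leNgt; apply/negP => y1.
suff : a x < 1 by rewrite x1 ltxx.
by rewrite -(subrK y x); apply: absD_lt.
Qed.

Lemma abs_natr_le1 n : a n%:R <= 1.
Proof.
elim: n => [|n IH]; first by rewrite abs0 ler01.
by rewrite -natr1; apply: absD_le; rewrite ?abs1.
Qed.

Lemma abs_intr_le1 (m : int) : a m%:~R <= 1.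
Proof. by case: m => n; rewrite ?NegzE ?mulrNz ?absN abs_natr_le1. Qed.

Lemma small_power (r e : R) : 0 <= r -> r < 1 -> 0 < e -> exists n, r ^+ n < e.
Proof.
move=> r0 r1 e0; have [->|rn0] := eqVneq r 0.
  by exists 1%N; rewrite expr1.
apply/not_existsP => H.
have rp : 0 < r by rewrite lt_def rn0.
have : r^-1 <= 1.
  apply: (@bounded_powers_le1 R _ e^-1) => k.
  by rewrite exprVn lef_pV2 ?posrE ?exprn_gt0 // leNgt; apply/negP/H.
by rewrite invf_le1 // leNgt r1.
Qed.

Lemma abs_eq_of_lt x y : (forall e, 0 < e -> a (x - y) < e) -> x = y.
Proof.
move=> H; apply/eqP; rewrite -subr_eq0 -(abs_eq0 a) eq_le abs_ge0 andbT.
rewrite leNgt; apply/negP => p; by have := H _ p; rewrite ltxx.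
Qed.

Definition cauchy_seq (u : nat -> F) := forall e : R, 0 < e ->
  exists n0, forall m n, (n0 <= m)%N -> (n0 <= n)%N -> a (u m - u n) < e.

Definition cvg_seq (u : nat -> F) l := forall e : R, 0 < e ->
  exists n0, forall n, (n0 <= n)%N -> a (u n - l) < e.

(** By the ultrametric inequality the first step dominates all later ones, so no sum of a geometric
    series enters the bound. *)
Lemma abs_geom_dist (u : nat -> F) (r : R) : 0 <= r -> r <= 1 ->
  (forall n, a (u n.+1 - u n) <= r ^+ n) ->
  forall n k, a (u (n + k)%N - u n) <= r ^+ n.
Proof.
move=> r0 r1 ur n; elim=> [|k IH]; first by rewrite addn0 subrr abs0 exprn_ge0.
rewrite addnS -(subrKA (u (n + k)%N)); apply: absD_le => //.
by apply: le_trans (ur _) _; rewrite exprD ler_piMr ?exprn_ge0 ?exprn_ile1.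
Qed.

Lemma geom_cauchy (u : nat -> F) (r : R) : 0 <= r -> r < 1 ->
  (forall n, a (u n.+1 - u n) <= r ^+ n) -> cauchy_seq u.
Proof.
move=> r0 r1 ur e e0; have [n0 rn] := small_power r0 r1 e0.
have H n : (n0 <= n)%N -> a (u n - u n0) < e.
  move=> nn; rewrite -(subnKC nn); apply: le_lt_trans rn.
  exact: (abs_geom_dist r0 (ltW r1)).
exists n0 => m n mn nn; rewrite -(subrKA (u n0)); apply: absD_lt; first exact: H.
by rewrite abs_distC H.
Qed.

Lemma geom_cvg (u : nat -> F) (r : R) l : 0 <= r -> r < 1 ->
  (forall n, a (u n.+1 - u n) <= r ^+ n) -> cvg_seq u l ->
  forall n, a (l - u n) <= r ^+ n.
Proof.
move=> r0 r1 ur ul n; rewrite leNgt; apply/negP => H.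
have [n0 /(_ (n + n0)%N (leq_addl _ _)) h] := ul _ (le_lt_trans (exprn_ge0 n r0) H).
suff : a (l - u n) < a (l - u n) by rewrite ltxx.
rewrite -{1}(subrKA (u (n + n0)%N)). apply: absD_lt; first by rewrite [X in X < _]abs_distC.
by apply: le_lt_trans H; exact: (abs_geom_dist r0 (ltW r1)).
Qed.

End Ultrametric.

Section Completeness.

Variables (R : realType) (p : nat) (Q : fieldType) (a0 : nonarch_abs R Q).
Hypothesis hQ : is_Qp p a0.
Variables (N : splittingFieldType Q) (a : nonarch_abs R N).
Hypothesis ha : forall x : Q, a x%:A = a0 x.

Lemma absZ c (x : N) : a (c *: x) = a0 c * a x.
Proof. by rewrite -mulr_algl absM ha. Qed.

(** Induction on the dimension, splitting off a line spanned by [v]. The complement [U'] is complete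
    by induction, so [v] has positive distance [d] from it. This distance bounds the coordinate
    along [v] by the absolute value of the vector, hence both components of a Cauchy sequence are
    Cauchy. *)
Lemma vspace_complete (U : {vspace N}) (u : nat -> N) :
  (forall n, u n \in U) -> cauchy_seq a u -> exists2 l, l \in U & cvg_seq a u l.
Proof.
have [k] := ubnP (\dim U); elim: k U u => // k IH U u dimU uU cu.
have [U0|] := eqVneq U 0%VS.
  exists 0; rewrite ?mem0v // => e e0; exists 0%N => n _.
  by have := uU n; rewrite U0 memv0 => /eqP->; rewrite subrr abs0.
rewrite -vpick0 => v0; have vU := memv_pick U; set v := vpick U in v0 vU.
pose U' := (U :\: <[v]>)%VS.
have capU : (U :&: <[v]>)%VS = <[v]>%VS by apply/capv_idPr.
have UE : (U' + <[v]>)%VS = U by have := addv_diff_cap U <[v]>; rewrite capU.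
have dimU' : (\dim U' < k)%N.
  have := dimv_cap_compl U <[v]>; rewrite capU dim_vline v0 => e.
  by move: dimU; rewrite -e add1n.
have vU' : v \notin U'.
  apply/negP => vU'; have := capv_diff U <[v]>.
  move/eqP; rewrite -subv0 => /subvP/(_ v).
  by rewrite memv_cap vU' memv_line memv0 (negPf v0) => /(_ isT).
have [d d0 dP] : exists2 d, 0 < d & forall w, w \in U' -> d <= a (v - w).
  apply: contrapT => H.
  have {}H (n : nat) : exists w, w \in U' /\ a (v - w) < (n.+1%:R)^-1.
    apply: contrapT => Hn; apply: H; exists (n.+1%:R)^-1.
      by rewrite invr_gt0 ltr0n.
    by move=> w wU; rewrite leNgt; apply/negP => h; apply: Hn; exists w.
  have [s sP] := choice H.
  have sv : cvg_seq a s v.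
    move=> e e0; exists (Num.bound e^-1) => n nb; rewrite abs_distC.
    apply: lt_trans (sP n).2 _; rewrite invf_plt ?posrE ?ltr0n //.
    apply: lt_le_trans (archi_boundP _) _; first by rewrite invr_ge0 ltW.
    by rewrite ler_nat ltnW.
  have [||l lU sl] := IH U' s dimU'; first by move=> n; have [] := sP n.
    move=> e e0; have [n0 h] := sv e e0; exists n0 => m n mn nn.
    by rewrite -(subrKA v); apply: absD_lt; rewrite ?[a (v - _)]abs_distC h.
  move/negP: vU'; apply; suff -> : v = l by [].
  apply: (@abs_eq_of_lt _ _ a) => e e0.
  have [n1 h1] := sv e e0; have [n2 h2] := sl e e0.
  rewrite -(subrKA (s (maxn n1 n2))); apply: absD_lt.
    by rewrite abs_distC h1 // leq_maxl.
  by rewrite h2 // leq_maxr.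
have dec n : exists c : N * Q, c.1 \in U' /\ u n = c.1 + c.2 *: v.
  have := uU n; rewrite -UE => /memv_addP[w wU [_ /vlineP[c ->] ->]].
  by exists (w, c).
have [c cP] := choice dec.
have lam w b : w \in U' -> d * a0 b <= a (w + b *: v).
  move=> wU; have [->|b0] := eqVneq b 0; first by rewrite abs0 mulr0 abs_ge0.
  have -> : w + b *: v = b *: (v - (- b^-1 *: w)).
    by rewrite scalerBr scalerA mulrN divff // scaleN1r opprK addrC.
  rewrite absZ mulrC ler_wpM2l ?abs_ge0 // dP // memvZ //.
have clam : cauchy_seq a0 (fun n => (c n).2).
  move=> e e0; have [n0 h] := cu (d * e) (mulr_gt0 d0 e0).
  exists n0 => m n mn nn; rewrite -(ltr_pM2l d0).
  apply: le_lt_trans (h m n mn nn).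
  apply: le_trans (lam ((c m).1 - (c n).1) _ _) _.
    by rewrite memvB // ?(cP _).1.
  by rewrite !(cP _).2 scalerBl opprD addrACA lexx.
have [l0 ll0] := Qp_complete hQ clam.
have cl0 : cvg_seq a (fun n => (c n).2 *: v) (l0 *: v).
  move=> e e0; have av : 0 < a v by rewrite lt_def abs_eq0 v0 abs_ge0.
  have [n0 h] := ll0 (e / a v) (divr_gt0 e0 av).
  by exists n0 => n nn; rewrite -scalerBl absZ -ltr_pdivlMr // h.
have [||l1 l1U ll1] := IH U' (fun n => (c n).1) dimU'.
- by move=> n; rewrite (cP n).1.
- move=> e e0; have [n1 h1] := cu e e0; have [n2 h2] := cl0 e e0.
  exists (maxn n1 n2) => m n; rewrite !geq_max => /andP[m1 m2] /andP[k1 k2].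
  have E i : (c i).1 = u i - (c i).2 *: v by rewrite (cP i).2 addrK.
  have -> : (c m).1 - (c n).1 = (u m - u n) -
      (((c m).2 *: v - l0 *: v) - ((c n).2 *: v - l0 *: v)) by rewrite !E; ring.
  by apply: absB_lt; [exact: h1|apply: absB_lt; exact: h2].
exists (l1 + l0 *: v); first by rewrite memvD ?memvZ // -UE (subvP (addvSl _ _)).
move=> e e0; have [n1 h1] := ll1 e e0; have [n2 h2] := cl0 e e0.
exists (maxn n1 n2) => n; rewrite geq_max => /andP[k1 k2].
by rewrite (cP n).2 opprD addrACA; apply: absD_lt; [exact: h1|exact: h2].
Qed.

Lemma vspace_geom_cvg (U : {vspace N}) (u : nat -> N) (r : R) :
  0 <= r -> r < 1 -> (forall n, u n \in U) ->
  (forall n, a (u n.+1 - u n) <= r ^+ n) ->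
  exists2 l, l \in U & forall n, a (l - u n) <= r ^+ n.
Proof.
move=> r0 r1 uU ur; have [l lU ul] := vspace_complete uU (geom_cauchy r0 r1 ur).
by exists l => //; exact: geom_cvg ul.
Qed.

End Completeness.

(** * Extensions of the 2-adic numbers *)

Section TwoAdic.

Variables (R : realType) (Q : fieldType) (a0 : nonarch_abs R Q).
Hypothesis hQ : is_Qp 2 a0.
Variables (N : splittingFieldType Q) (a : nonarch_abs R N).
Hypothesis ha : forall x : Q, a x%:A = a0 x.

Lemma Q2_abs2_lt1 : a0 2%:R < 1.
Proof.
have := Qp_ratr hQ 2%:R; rewrite ratr_nat => ->.
rewrite /padic_abs (_ : (2%:R == 0 :> rat) = false) //.
rewrite (_ : numq 2%:R = 2) // (_ : denq 2%:R = 1) //=.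
by rewrite logn1 logn_prime //= sub0r exprN1 invf_lt1 ?ltr1n ?ltr0n.
Qed.

Lemma Q2_abs2_gt0 : 0 < a0 2%:R.
Proof.
have := Qp_ratr hQ 2%:R; rewrite ratr_nat => ->.
rewrite /padic_abs (_ : (2%:R == 0 :> rat) = false) //.
by rewrite exprz_gt0.
Qed.

Lemma Q2_abs_odd (m : int) : odd `|m|%N -> a0 m%:~R = 1.
Proof.
move=> om; apply: (@abs_eq1 _ _ _ 1); first exact: abs1.
have [k ->] : exists k : int, m = 1 - 2 * k.
  exists ((1 - m) %/ 2)%Z.
  have : (2 %| 1 - m)%Z.
    by rewrite dvdzE dvdn2; case: m om => n /= on; rewrite ?NegzE; lia.
  by move/divzK; rewrite mulrC => ->; rewrite subKr.
rewrite intrB subKr intrM absM; apply: le_lt_trans Q2_abs2_lt1.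
by rewrite ler_piMr ?abs_ge0 ?abs_intr_le1.
Qed.

Lemma Q2_abs_even (m : int) : ~~ odd `|m|%N -> a0 m%:~R < 1.
Proof.
move=> om; have /divzK : (2 %| m)%Z by rewrite dvdzE dvdn2.
move<-; rewrite intrM absM; apply: le_lt_trans Q2_abs2_lt1.
by rewrite ler_piMl ?abs_ge0 ?abs_intr_le1.
Qed.

(** The residue field is that of two elements: an approximating rational of absolute value at most 1
    has odd denominator in lowest terms, and [b] is the parity of its numerator. *)
Lemma Q2_residue (q : Q) : a0 q <= 1 -> exists b : bool, a0 (q - b%:R) < 1.
Proof.
move=> q1; have [r rq] := Qp_dense hQ q ltr01.
have r1 : a0 (ratr r) <= 1.
  by rewrite -(subKr q (ratr r)); apply: absB_le => //; exact: ltW.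
have den_odd : odd `|denq r|%N.
  apply/negPn/negP => ev; have num_odd : odd `|numq r|%N.
    apply/negPn/negP => ev'; have := coprime_num_den r; rewrite /coprime.
    have : (2 %| gcdn `|numq r| `|denq r|)%N by rewrite dvdn_gcd !dvdn2 ev ev'.
    by move=> h /eqP e; rewrite e in h.
  have := r1; rewrite absM absV (Q2_abs_odd num_odd) mul1r.
  have d0 : 0 < a0 (denq r)%:~R.
    rewrite lt_def abs_ge0 andbT; have := Qp_ratr hQ (denq r)%:~R.
    rewrite ratr_int => ->; rewrite /padic_abs intr_eq0 denq_eq0 /=.
    by rewrite gt_eqF ?exprz_gt0.
  by rewrite invf_le1 // leNgt Q2_abs_even.
have step (b : bool) : ~~ odd (absz (numq r - b%:R * denq r)%R) -> a0 (q - b%:R) < 1.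
  move=> ev; rewrite -(subrKA (ratr r)); apply: absD_lt => //.
  have dn : (denq r)%:~R != 0 :> Q.
    by rewrite -(abs_eq0 a0) Q2_abs_odd // oner_eq0.
  have -> : ratr r - b%:R = (numq r - b%:R * denq r)%:~R / (denq r)%:~R :> Q.
    by rewrite intrB mulrBl intrM mulfK // natz.
  by rewrite absM absV (Q2_abs_odd den_odd) invr1 mulr1 Q2_abs_even.
exists (odd `|numq r|%N); apply: step; case o: (odd _); lia.
Qed.

Lemma abs2E : a 2%:R = a0 2%:R.
Proof. by rewrite -ha scaler_nat. Qed.

Lemma abs2_lt1 : a 2%:R < 1.
Proof. by rewrite abs2E Q2_abs2_lt1. Qed.

Lemma abs2_gt0 : 0 < a 2%:R.
Proof. by rewrite abs2E Q2_abs2_gt0. Qed.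

(** Odd numbers have absolute value 1, and a positive [k <= 2 ^ m] has at most [m] factors 2. *)
Lemma abs_natr_ge m k : (0 < k)%N -> (k <= 2 ^ m)%N -> a 2%:R ^+ m <= a k%:R.
Proof.
have odd_case j : odd j -> a j%:R = 1.
  by move=> oj; rewrite -[j%:R]scaler_nat ha (@Q2_abs_odd j).
elim: m k => [|m IH] k k0 km.
  by rewrite expr0; case: k k0 km => [|[|]] // _ _; rewrite abs1.
have [ok|ek] := boolP (odd k).
  by rewrite (odd_case k ok) exprn_ile1 ?abs_ge0 // ltW // abs2_lt1.
have kE : k = (k./2 * 2)%N by rewrite muln2 -[LHS]odd_double_half (negPf ek).
rewrite kE natrM absM exprSr ler_wpM2r ?abs_ge0 // IH //; last first.
  by move: km; rewrite expnS {1}kE mulnC leq_pmul2l.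
by move: k0; rewrite {1}kE muln_gt0 => /andP[].
Qed.

Lemma charN0 : [pchar N] =i pred0.
Proof.
move=> p; rewrite !inE; apply/negP => /andP[pp /eqP p0].
have : a 2%:R ^+ p <= a p%:R.
  by rewrite abs_natr_ge ?prime_gt0 // ltnW // ltn_expl.
by rewrite p0 abs0 leNgt exprn_gt0 // abs2_gt0.
Qed.

Lemma natN_neq0 n : (0 < n)%N -> n%:R != 0 :> N.
Proof. by move=> n0; have /pcharf0P -> := charN0; rewrite -lt0n. Qed.

Let horner_frob (x : N) (s : seq bool) : N :=
  foldr (fun (b : bool) y => b%:R * x + y ^+ 2) 0 s.

Let ring_le1 (E : {subfield N}) x s : x \in E -> a x <= 1 ->
  horner_frob x s \in E /\ a (horner_frob x s) <= 1.
Proof.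
move=> xE x1; elim: s => [|b s [IHE IH1]] /=; first by rewrite mem0v abs0 ler01.
rewrite rpredD ?rpredM ?rpredX ?rpred_nat //; split=> //.
apply: absD_le; first by rewrite absM mulr_ile1 ?abs_ge0 ?abs_natr_le1.
by rewrite absX exprn_ile1 ?abs_ge0.
Qed.

Lemma abs_sqrD (x y : N) : a x <= 1 -> a y <= 1 ->
  a ((x + y) ^+ 2 - (x ^+ 2 + y ^+ 2)) < 1.
Proof.
move=> x1 y1; have -> : (x + y) ^+ 2 - (x ^+ 2 + y ^+ 2) = 2%:R * (x * y) by ring.
rewrite absM; apply: le_lt_trans abs2_lt1.
by rewrite ler_piMr ?abs_ge0 // absM mulr_ile1 ?abs_ge0.
Qed.

Lemma abs_sqrB (x y : N) : a x <= 1 -> a y <= 1 -> a (x - y) < 1 ->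
  a (x ^+ 2 - y ^+ 2) < 1.
Proof.
move=> x1 y1 xy; rewrite subr_sqr absM.
by apply: le_lt_trans xy; rewrite ler_piMr ?abs_ge0 //; apply: absD_le.
Qed.

Let frob_sum x (s : seq bool) : a x <= 1 ->
  a (\sum_(i < size s) (nth false s i)%:R * x ^+ (2 ^ i) - horner_frob x s) < 1.
Proof.
move=> x1; have [_ h1] := @ring_le1 {:N} x s (memvf x) x1.
elim: s {h1} => [|b s IH] /=; first by rewrite big_ord0 subrr abs0 ltr01.
have [_ h1] := @ring_le1 {:N} x s (memvf x) x1.
rewrite big_ord_recl /= expn0 expr1 opprD addrACA subrr add0r.
set S := \sum_(i < size s) (nth false s i)%:R * x ^+ (2 ^ i) in IH.
have term1 i : a ((nth false s i)%:R * x ^+ (2 ^ i)) <= 1.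
  by rewrite absM mulr_ile1 ?abs_ge0 ?abs_natr_le1 // absX exprn_ile1 ?abs_ge0.
have S1 : a S <= 1 by apply: abs_sum_le => // i _.
rewrite -(subrKA (S ^+ 2)); apply: absD_lt; last exact: abs_sqrB.
rewrite abs_distC /S.
pose P n := a ((\sum_(i < n) (nth false s i)%:R * x ^+ (2 ^ i)) ^+ 2 -
  \sum_(i < n) (nth false s i)%:R * x ^+ (2 ^ bump 0 i)) < 1.
suff : P (size s) by [].
elim: (size s) => [|n IHn]; rewrite /P.
  by rewrite !big_ord0 expr0n subr0 abs0 ltr01.
rewrite !big_ord_recr /=.
set A := \sum_(i < n) _ in IHn *; set B := \sum_(i < n) _ in IHn *.
have A1 : a A <= 1 by apply: abs_sum_le => // i _.
set c := (nth false s n)%:R; set y := c * _; set y' := c * x ^+ _.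
have -> : y' = y ^+ 2.
  rewrite /y /y' exprMn -exprM -expnSr /bump add1n /c.
  by case: (nth false s n); rewrite ?expr1n // expr0n !mul0r.
rewrite (_ : _ - _ = (A + y) ^+ 2 - (A ^+ 2 + y ^+ 2) + (A ^+ 2 - B)); last by ring.
by apply: absD_lt; [apply: abs_sqrD; rewrite // /y term1|].
Qed.

(* A nontrivial Q_2-linear relation between the x^(2^i), reduced modulo 2, is a
   nonzero additive polynomial over F_2 that kills x in the residue field;
   removing its Frobenius factor expresses x as a square. *)
Lemma residue_sqrt (E : {subfield N}) x : x \in E -> a x <= 1 ->
  exists y, [/\ y \in E, a y <= 1 & a (x - y ^+ 2) < 1].
Proof.
move=> xE x1; pose n := \dim {:N}.
pose X := [tuple x ^+ (2 ^ i) | i < n.+1].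
have nfX : ~~ free X.
  apply/negP => fX; have := dimvS (subvf <<X>>%VS).
  by move/eqP: fX => ->; rewrite size_tuple ltnn.
have [k [k0 [j kj]]] : exists k : 'I_n.+1 -> Q,
    \sum_(i < n.+1) k i *: x ^+ (2 ^ i) = 0 /\ exists j, k j != 0.
  apply: contrapT => H; move/negP: nfX; apply; apply/freeP => k k0 i.
  apply: contrapT => ki; apply: H; exists k; split; last by exists i; apply/eqP.
  by rewrite -[RHS]k0; apply: eq_bigr => l _; rewrite -tnth_nth tnth_mktuple.
(* Dividing by a coefficient of largest absolute value makes the relation integral and one
   coefficient equal to 1, so that its reduction is nonzero. *)
pose j0 := [arg max_(i > j) a0 (k i)]%O.
have kmax i : a0 (k i) <= a0 (k j0).
  by rewrite /j0; case: arg_maxP => // i0 _ /(_ i); exact.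
have kj0 : k j0 != 0.
  rewrite -(abs_eq0 a0) gt_eqF //; apply: lt_le_trans (kmax j).
  by rewrite lt_def abs_eq0 kj abs_ge0.
have q1 i : a0 (k i / k j0) <= 1.
  by rewrite absM absV ler_pdivrMr ?mul1r // lt_def abs_eq0 kj0 abs_ge0.
have [b bP] := choice (fun i => Q2_residue (q1 i)).
have bj0 : b j0.
  have := bP j0; rewrite divff //; case: (b j0) => //.
  by rewrite subr0 abs1 ltxx.
pose s := [seq b i | i <- enum 'I_n.+1].
have ss : size s = n.+1 by rewrite size_map size_enum_ord.
have sb (i : 'I_n.+1) : nth false s i = b i.
  by rewrite (nth_map i) ?size_enum_ord // nth_ord_enum.
have hs : a (horner_frob x s) < 1.
  rewrite -(subKr (\sum_(i < size s) (nth false s i)%:R * x ^+ (2 ^ i))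
    (horner_frob x s)).
  apply: absB_lt; last exact: frob_sum.
  rewrite ss.
  have q0 : \sum_(i < n.+1) (k i / k j0) *: x ^+ (2 ^ i) = 0.
    transitivity ((k j0)^-1 *: \sum_(i < n.+1) k i *: x ^+ (2 ^ i)).
      by rewrite scaler_sumr; apply: eq_bigr => i _; rewrite scalerA mulrC.
    by rewrite k0 scaler0.
  rewrite -[X in a X]subr0 -[X in _ - X]q0 -sumrB.
  elim/big_ind: _ => [|u v|i _]; first by rewrite abs0 ltr01.
    exact: absD_lt.
  rewrite sb mulr_natl -scaler_nat -scalerBl (absZ ha) //.
  rewrite abs_distC; apply: le_lt_trans (bP i).
  by rewrite ler_piMr ?abs_ge0 // absX exprn_ile1 ?abs_ge0.
have : true \in s by apply/mapP; exists j0; rewrite ?mem_enum.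
(* A leading [false] makes the value the square of the value on [s'], which is then small too. The
   first [true] gives [x + y ^+ 2] small with [y] the value on [s'], and signs do not matter modulo
   2. *)
elim: (s) hs => // -[] s' IH /= hs; last first.
  rewrite inE /=; apply: IH; move: hs; rewrite mul0r add0r absX => h.
  rewrite ltNge; apply/negP => h'; move: h; rewrite ltNge exprn_ege1 //.
move=> _; have [hE h1] := ring_le1 s' xE x1.
exists (horner_frob x s'); split=> //; rewrite mul1r in hs.
rewrite (_ : x - _ = x + horner_frob x s' ^+ 2 - 2%:R * horner_frob x s' ^+ 2);
  last by ring.
apply: absB_lt => //; rewrite absM; apply: le_lt_trans abs2_lt1.
by rewrite ler_piMr ?abs_ge0 // absX exprn_ile1 ?abs_ge0.
Qed.

End TwoAdic.

(** * Functions on characters: Hensel's lemma and generation *)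

Section CharacterSpan.

Variables (R : realType) (Q : fieldType) (a0 : nonarch_abs R Q).
Hypothesis hQ : is_Qp 2 a0.
Variables (N : splittingFieldType Q) (a : nonarch_abs R N).
Hypothesis ha : forall x : Q, a x%:A = a0 x.
Variables (gT : finGroupType) (Z : {group gT}) (I : Type) (psi : I -> gT -> N).
Hypothesis psi1 : forall i, psi i 1%g = 1.
Hypothesis psiM : forall i, {in Z &, {morph psi i : x y / (x * y)%g >-> x * y}}.
Hypothesis psi_abs : forall i x, x \in Z -> a (psi i x) = 1.
Implicit Types (E : {subfield N}) (r s : R) (f g : I -> N).

(* [char_span E r f] says that [f] is evaluation at the characters [psi i] of an
   element of [E[Z]] whose coefficients have absolute value at most [r]. *)
Definition char_span E r f := exists l : gT -> N,
  [/\ forall x, l x \in E, forall x, a (l x) <= r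
    & forall i, f i = \sum_(x in Z) l x * psi i x].

Section Fixed.
Variable E : {subfield N}.
Local Notation C := (char_span E).

Lemma char_span_le r s f : r <= s -> C r f -> C s f.
Proof.
by move=> rs [l [lE lr fl]]; exists l; split=> // x; apply: le_trans rs.
Qed.

Lemma char_span_ge0 r f : C r f -> 0 <= r.
Proof. by case=> l [_ /(_ 1%g) + _]; apply: le_trans; exact: abs_ge0. Qed.

Lemma char_span_abs r f i : C r f -> a (f i) <= r.
Proof.
move=> Cf; have r0 := char_span_ge0 Cf; case: Cf => l [_ lr ->].
by apply: abs_sum_le => // x Zx; rewrite absM psi_abs // mulr1.
Qed.

Lemma char_span_mono r c x : 0 <= r -> c \in E -> a c <= r -> x \in Z ->
  C r (fun i => c * psi i x).
Proof.
move=> r0 cE cr Zx; exists (fun y => if y == x then c else 0); split=> [y|y|i].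
- by case: eqP => _; rewrite ?mem0v.
- by case: eqP => _; rewrite ?abs0.
rewrite (bigD1 x) //= eqxx big1 ?addr0 // => y /andP[_ /negPf->].
by rewrite mul0r.
Qed.

Lemma char_span_const r c : 0 <= r -> c \in E -> a c <= r -> C r (fun=> c).
Proof.
move=> r0 cE cr; have := char_span_mono r0 cE cr (group1 Z).
by congr char_span; apply/funext => i; rewrite psi1 mulr1.
Qed.

Lemma char_span_nat n : C 1 (fun=> n%:R).
Proof. by apply: char_span_const; rewrite ?rpred_nat ?abs_natr_le1. Qed.

Lemma char_span1 : C 1 (fun=> 1).
Proof. exact: (char_span_nat 1). Qed.

Lemma char_span0 r : 0 <= r -> C r (fun=> 0).
Proof. by move=> r0; apply: char_span_const; rewrite ?mem0v ?abs0. Qed.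

Lemma char_spanD r f g : C r f -> C r g -> C r (fun i => f i + g i).
Proof.
move=> [l [lE lr fl]] [m [mE mr gm]]; exists (fun x => l x + m x).
split=> [x|x|i]; first by rewrite rpredD.
  exact: absD_le.
by rewrite fl gm -big_split; apply: eq_bigr => x _; rewrite mulrDl.
Qed.

Lemma char_spanZ r s c f : c \in E -> a c <= s -> C r f ->
  C (s * r) (fun i => c * f i).
Proof.
move=> cE cs Cf; have r0 := char_span_ge0 Cf.
case: Cf => l [lE lr fl]; exists (fun x => c * l x); split=> [x|x|i].
- by rewrite rpredM.
- by rewrite absM ler_pM ?abs_ge0.
by rewrite fl mulr_sumr; apply: eq_bigr => x _; rewrite mulrA.
Qed.

Lemma char_spanN r f : C r f -> C r (fun i => - f i).
Proof.
move=> [l [lE lr fl]]; exists (fun x => - l x); split=> [x|x|i].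
- by rewrite rpredN.
- by rewrite absN.
by rewrite fl -sumrN; apply: eq_bigr => x _; rewrite mulNr.
Qed.

Lemma char_spanB r f g : C r f -> C r g -> C r (fun i => f i - g i).
Proof. by move=> Cf Cg; apply: char_spanD => //; exact: char_spanN. Qed.

Lemma char_spanM r s f g : C r f -> C s g -> C (r * s) (fun i => f i * g i).
Proof.
move=> Cf Cg; have r0 := char_span_ge0 Cf; have s0 := char_span_ge0 Cg.
case: Cf => l [lE lr fl]; case: Cg => m [mE mr gm].
exists (fun x => \sum_(y in Z) l y * m (y^-1 * x)%g); split=> [x|x|i].
- by apply: rpred_sum => y _; rewrite rpredM.
- by apply: abs_sum_le => [|y _]; rewrite ?mulr_ge0 // absM ler_pM ?abs_ge0.
rewrite fl gm mulr_suml; under [RHS]eq_bigr do rewrite mulr_suml.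
rewrite exchange_big; apply: eq_bigr => y Zy /=.
rewrite mulr_sumr [RHS](reindex_inj (mulgI y)) /=.
apply: eq_big => [x|x Zx]; first by rewrite groupMl.
by rewrite mulKg psiM // mulrACA.
Qed.

Lemma char_spanMl r f g : C 1 f -> C r g -> C r (fun i => f i * g i).
Proof. by move=> Cf Cg; have := char_spanM Cf Cg; rewrite mul1r. Qed.

Lemma char_spanMr r f g : C r f -> C 1 g -> C r (fun i => f i * g i).
Proof. by move=> Cf Cg; have := char_spanM Cf Cg; rewrite mulr1. Qed.

Lemma char_span_sum r (J : Type) (t : seq J) (P : pred J) (F : J -> I -> N) :
  0 <= r -> (forall j, P j -> C r (F j)) ->
  C r (fun i => \sum_(j <- t | P j) F j i).
Proof.
move=> r0 CF; elim: t => [|j t IH].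
  have := char_span0 r0; congr char_span.
  by apply/funext => i; rewrite big_nil.
case Pj: (P j); last first.
  by move: IH; congr char_span; apply/funext => i; rewrite big_cons Pj.
have := char_spanD (CF j Pj) IH; congr char_span.
by apply/funext => i; rewrite big_cons Pj.
Qed.

(** The sum is formed coefficient by coefficient, in [E], which is complete as a subspace of [N]. *)
Lemma char_span_series r (d : nat -> I -> N) : 0 <= r -> r < 1 ->
  (forall n, C (r ^+ n) (d n)) ->
  exists2 f, C 1 f & forall n i, a (f i - \sum_(k < n) d k i) <= r ^+ n.
Proof.
move=> r0 r1 Cd; have [l lP] := choice Cd.
have lim x : exists y, y \in E /\
    forall n, a (y - \sum_(k < n) l k x) <= r ^+ n.
  have [n|n|y yE yP] := vspace_geom_cvg hQ ha (U := E)
    (u := fun n => \sum_(k < n) l k x) r0 r1.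
  - by apply: rpred_sum => k _; have [] := lP k.
  - by rewrite big_ord_recr /= addrAC subrr add0r; have [_ ->] := lP n.
  by exists y.
have [L LP] := choice lim.
exists (fun i => \sum_(x in Z) L x * psi i x).
  exists L; split=> // x; first by have [] := LP x.
  by have [_ /(_ 0%N)] := LP x; rewrite big_ord0 subr0 expr0.
move=> n i.
have -> : \sum_(k < n) d k i = \sum_(x in Z) (\sum_(k < n) l k x) * psi i x.
  under eq_bigr => k _ do have [_ _ ->] := lP k.
  by rewrite exchange_big; apply: eq_bigr => x _; rewrite mulr_suml.
rewrite -sumrB; apply: abs_sum_le => [|x Zx]; first exact: exprn_ge0.
by rewrite -mulrBl absM psi_abs // mulr1; have [_ ->] := LP x.
Qed.

(** The map [step] contracts by [r], since [b] and [c] lie in [C r], and its iterates from 0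
    converge to the solution. The cases used are [c = 0], which inverts [1 - b], and [b = 0], which
    solves quadratic equations. *)
Lemma quad_fixpoint r u b c : r < 1 -> C 1 u -> C r b -> C r c ->
  exists2 f, C 1 f & forall i, f i = u i + b i * f i + c i * f i ^+ 2.
Proof.
move=> r1 Cu Cb Cc; have r0 := char_span_ge0 Cb.
pose step f i := u i + b i * f i + c i * f i ^+ 2.
pose F n := iter n step (fun=> 0).
have stepC f : C 1 f -> C 1 (step f).
  move=> Cf; apply: char_spanD; last first.
    apply: char_span_le (ltW r1) _; apply: char_spanMr => //.
    by have := char_spanMl Cf Cf; congr char_span; apply/funext => i.
  apply: char_spanD => //.
  by apply: char_span_le (ltW r1) _; apply: char_spanMr.
have FC n : C 1 (F n) by elim: n => [|n /stepC //]; exact: char_span0.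
have FD n : C (r ^+ n) (fun i => F n.+1 i - F n i).
  elim: n => [|n IH]; first by rewrite expr0; apply: char_spanB; exact: FC.
  have CD : C 1 (fun i => F n.+1 i + F n i) by exact: char_spanD.
  have := char_spanD (char_spanM Cb IH) (char_spanMr (char_spanM Cc IH) CD).
  rewrite -exprS; congr char_span; apply/funext => i.
  have stepB f g : b i * (f i - g i) + c i * (f i - g i) * (f i + g i) =
    step f i - step g i by rewrite /step; ring.
  exact: (stepB (F n.+1) (F n)).
have [f Cf fP] := char_span_series r0 r1 FD.
have fF n i : a (f i - F n i) <= r ^+ n.
  suff <- : \sum_(k < n) (F k.+1 i - F k i) = F n i by [].
  elim: n => [|n IH]; first by rewrite big_ord0.
  by rewrite big_ord_recr /= IH addrC subrK.
exists f => // i; apply: (@abs_eq_of_lt _ _ a) => e e0.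
have [n rn] := small_power r0 r1 e0; apply: le_lt_trans rn.
have f1 := char_span_abs i Cf; have F1 := char_span_abs i (FC n).
have b1 : a (b i) <= 1 := le_trans (char_span_abs i Cb) (ltW r1).
have c1 : a (c i) <= 1 := le_trans (char_span_abs i Cc) (ltW r1).
have -> : f i - (u i + b i * f i + c i * f i ^+ 2) = (f i - F n.+1 i) -
  (f i - F n i) * (b i + c i * (f i + F n i)).
  by have -> : F n.+1 i = u i + b i * F n i + c i * F n i ^+ 2 by []; ring.
apply: absB_le; first by apply: le_trans (fF _ _) _; rewrite exprS ler_piMl ?exprn_ge0 // ltW.
rewrite absM; apply: le_trans (fF n i); rewrite ler_piMr ?abs_ge0 //.
apply: absD_le => //; rewrite absM mulr_ile1 ?abs_ge0 //.
exact: absD_le.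
Qed.

(** The solution is sought as [c * f], so that it inherits the bound [r]; the equation for [f]
    becomes [f = 1 - c * f ^+ 2]. *)
Lemma hensel_quadratic r c : r < 1 -> C r c ->
  exists2 f, C r f & forall i, f i + f i ^+ 2 = c i.
Proof.
move=> r1 Cc; have r0 := char_span_ge0 Cc.
have [f Cf fE] := quad_fixpoint r1 char_span1 (char_span0 r0) (char_spanN Cc).
exists (fun i => c i * f i) => [|i]; first exact: char_spanMr.
have f1 : f i + c i * f i ^+ 2 = 1 by rewrite {1}fE /=; ring.
by rewrite -[RHS]mulr1 -f1; ring.
Qed.

(** One square root at a time: [1 + 2^(j+3) c] is the square of [1 + 2^(j+2) f] as soon as
    [f + 2^(j+1) f^2 = c], a fixed point equation with small quadratic coefficient. *)
Lemma char_span_pow2_root j c : C 1 c -> exists2 f, C 1 f &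
  forall i, (1 + 4%:R * f i) ^+ (2 ^ j) = 1 + (2 ^ j.+2)%:R * c i.
Proof.
elim: j c => [|j IH] c Cc; first by exists c => // i; rewrite expn0 expr1.
have C2 : C (a 2%:R) (fun=> - (2 ^ j.+1)%:R).
  apply: char_span_const; rewrite ?abs_ge0 ?rpredN ?rpred_nat // absN.
  by rewrite expnS natrM absM ler_piMr ?abs_ge0 ?abs_natr_le1.
have [f Cf fE] := quad_fixpoint (abs2_lt1 hQ ha) Cc (char_span0 (abs_ge0 a _)) C2.
have [g Cg gE] := IH f Cf; exists g => // i.
rewrite expnSr exprM gE.
have -> : c i = f i + (2 ^ j.+1)%:R * f i ^+ 2 by rewrite [X in X + _]fE; ring.
by rewrite !expnS !natrM; ring.
Qed.

(** * Multiplicative generation reduced to additive generation modulo the maximal ideal *)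

Section Generation.

(** [V c] stands for [1 + 4 c] being attained. Then [VM] is closure under products, [Vsq] says that
    the squares [(1 + 2 c)^2] are attained, and [VS] accounts for the noncentral elements of the
    group. *)
Variables (V : (I -> N) -> Prop) (S : {pred gT}).
Hypothesis VM : forall c c', C 1 c -> C 1 c' -> V c -> V c' ->
  V (fun i => c i + c' i + 4%:R * c i * c' i).
Hypothesis Vsq : forall c, C 1 c -> V (fun i => c i + c i ^+ 2).
Hypothesis VS : forall c x, c \in E -> a c <= 1 -> x \in S ->
  V (fun i => - c ^+ 2 * psi i x).
Hypothesis SZ : {subset S <= Z}.
Hypothesis S_ex : exists x, x \in S.
Hypothesis Z2 : (2.-group Z)%g.

Let approx c := C 1 c /\
  exists r, exists2 d, r < 1 & C r d /\ V (fun i => c i + d i).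

(** With [f] the inverse of [1 + 4 (c + d)], one has [1 + 4 c = (1 + 4 (c + d)) (1 - 4 d f)]. As
    [- d f] is small, Hensel's lemma writes it as [w + w^2], so the second factor is attained as
    well. *)
Let approxV c : approx c -> V c.
Proof.
move=> [Cc [r [d r1 [Cd Vd]]]].
have Ccd : C 1 (fun i => c i + d i).
  by apply: char_spanD => //; exact: char_span_le (ltW r1) Cd.
have C4 : C (a 2%:R) (fun i => - 4%:R * (c i + d i)).
  apply: char_spanMr Ccd; apply: char_span_const; rewrite ?abs_ge0 ?rpredN ?rpred_nat //.
  by rewrite absN (natrM _ 2 2) absM ler_piMr ?abs_ge0 ?abs_natr_le1.
have [f Cf fE] := quad_fixpoint (abs2_lt1 hQ ha) char_span1 C4 (char_span0 (abs_ge0 a _)).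
have Ce : C r (fun i => - d i * f i).
  by apply: char_spanMr => //; exact: char_spanN.
have [w Cw wE] := hensel_quadratic r1 Ce.
have Vw := Vsq (char_span_le (ltW r1) Cw).
have := VM Ccd _ Vd Vw.
have -> : (fun i => w i + w i ^+ 2) = (fun i => - d i * f i) by apply/funext.
move/(_ (char_span_le (ltW r1) Ce)); congr V; apply/funext => i.
have f1 : f i + 4%:R * (c i + d i) * f i = 1.
  by rewrite {1}fE /= mul0r addr0 !mulNr subrK.
have /= := congr1 ( *%R (d i)) f1; rewrite mulr1 => dE.
by rewrite wE -[RHS](addrK (d i)) -[X in _ = _ - X]dE; ring.
Qed.
Let approxW c : C 1 c -> V c -> approx c.
Proof.
move=> Cc Vc; split=> //; exists 0; exists (fun=> 0); first exact: ltr01.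
split; first exact: char_span0.
by move: Vc; congr V; apply/funext => i; rewrite addr0.
Qed.

Let approx_close r c c' : r < 1 -> C 1 c' -> C r (fun i => c i - c' i) ->
  approx c -> approx c'.
Proof.
move=> r1 Cc' Ccc' [Cc [s [d s1 [Cd Vd]]]]; split=> //.
exists (Num.max r s); exists (fun i => c i - c' i + d i).
  by rewrite gt_max r1.
split; last by move: Vd; congr V; apply/funext => i; ring.
by apply: char_spanD; [apply: char_span_le Ccc'|apply: char_span_le Cd];
  rewrite le_max lexx ?orbT.
Qed.

(** The product law [VM] is addition up to [4 c c'], which is small. *)
Let approxD c c' : approx c -> approx c' -> approx (fun i => c i + c' i).
Proof.
move=> ac ac'; have Vc := approxV ac; have Vc' := approxV ac'.
have [Cc _] := ac; have [Cc' _] := ac'.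
have C4 : C (a 2%:R) (fun i => 4%:R * c i * c' i).
  apply: char_spanMr => //; apply: char_spanMr => //.
  apply: char_span_const; rewrite ?abs_ge0 ?rpred_nat //.
  by rewrite (natrM _ 2 2) absM ler_piMr ?abs_ge0 ?abs_natr_le1.
split; first exact: char_spanD.
exists (a 2%:R); exists (fun i => 4%:R * c i * c' i); first exact: (abs2_lt1 hQ ha).
by split=> //; exact: VM.
Qed.

Let good x := forall c, c \in E -> a c <= 1 -> approx (fun i => c * psi i x).

Let C_mono c x : x \in Z -> c \in E -> a c <= 1 -> C 1 (fun i => c * psi i x).
Proof. by move=> Zx cE c1; apply: char_span_mono. Qed.

(* If [c = b^2] in the residue field, then [c psi_x] and [b^2 psi_x] differ by
   an element of the radical. *)
Let good_sqr x : x \in Z ->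
  (forall b, b \in E -> a b <= 1 -> approx (fun i => b ^+ 2 * psi i x)) ->
  good x.
Proof.
move=> Zx H c cE c1; have [b [bE b1 cb]] := residue_sqrt hQ ha cE c1.
rewrite abs_distC in cb; apply: approx_close cb (C_mono Zx cE c1) _ (H b bE b1).
have := @char_span_mono (a (b ^+ 2 - c)) (b ^+ 2 - c) x (abs_ge0 a _).
rewrite rpredB ?rpredX // lexx Zx => /(_ isT isT isT).
by congr char_span; apply/funext => i; rewrite mulrBl.
Qed.

Let good_S x : x \in S -> good x.
Proof.
move=> Sx; have Zx := SZ Sx => c cE c1.
have bE b : b \in E -> a b <= 1 -> b ^+ 2 \in E /\ a (b ^+ 2) <= 1.
  by move=> bE b1; rewrite rpredX // absX exprn_ile1 ?abs_ge0.
(* The root is taken of [- c] because [VS] provides the coefficients [- b ^+ 2]. *)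
have [] := residue_sqrt hQ ha (x := - c) (E := E); rewrite ?rpredN ?absN //.
move=> b [b_E b1 cb].
have [b2E b21] := bE b b_E b1.
apply: (@approx_close (a (- c - b ^+ 2)) (fun i => - b ^+ 2 * psi i x)) => //.
- exact: C_mono.
- have := @char_span_mono (a (- c - b ^+ 2)) (- c - b ^+ 2) x (abs_ge0 a _).
  rewrite rpredB ?rpredN // lexx Zx => /(_ isT isT isT).
  by congr char_span; apply/funext => i; rewrite -mulrBl addrC.
apply: approxW; last exact: VS.
by apply: C_mono; rewrite ?rpredN ?absN.
Qed.

Let good_down x : x \in Z -> good (x ^+ 2)%g -> good x.
Proof.
move=> Zx gx2 c cE c1.
have Vc := approxW _ (Vsq (C_mono Zx cE c1)).
have -> : (fun i => c * psi i x) =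
  (fun i => c * psi i x + (c * psi i x) ^+ 2 + - c ^+ 2 * psi i (x ^+ 2)%g).
  by apply/funext => i; rewrite expgS expg1 psiM //; ring.
apply: approxD; last by apply: gx2; rewrite ?rpredN ?rpredX // absN absX exprn_ile1 ?abs_ge0.
apply: Vc; apply: char_spanD; first exact: C_mono.
by have := char_spanMl (C_mono Zx cE c1) (C_mono Zx cE c1).
Qed.

Let good_up x : x \in Z -> good x -> good (x ^+ 2)%g.
Proof.
move=> Zx gx; apply: good_sqr => [|b bE b1]; first exact: groupX.
have -> : (fun i => b ^+ 2 * psi i (x ^+ 2)%g) =
  (fun i => b * psi i x + (b * psi i x) ^+ 2 + - b * psi i x).
  by apply/funext => i; rewrite expgS expg1 psiM //; ring.
apply: approxD; last by apply: gx; rewrite ?rpredN ?absN.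
apply: approxW; last exact: Vsq (C_mono Zx bE b1).
apply: char_spanD; first exact: C_mono.
by have := char_spanMl (C_mono Zx bE b1) (C_mono Zx bE b1).
Qed.

Let iter_sqr x k : iter k (fun y : gT => y ^+ 2)%g x = (x ^+ (2 ^ k))%g.
Proof. by elim: k => [|k IH]; rewrite ?expg1 //= IH -expgM expnSr. Qed.

Let sqr_trivial x : x \in Z -> exists k, iter k (fun y : gT => y ^+ 2)%g x = 1%g.
Proof.
move=> Zx; have [k ok] := p_natP (mem_p_elt Z2 Zx).
by exists k; rewrite iter_sqr -ok expg_order.
Qed.

Let iterZ x k : x \in Z -> iter k (fun y : gT => y ^+ 2)%g x \in Z.
Proof. by move=> Zx; rewrite iter_sqr groupX. Qed.

Let good1 : good 1%g.
Proof.
have [x Sx] := S_ex; have Zx := SZ Sx; have [k <-] := sqr_trivial Zx.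
elim: k => [|k IH]; first exact: good_S.
by apply: good_up => //; exact: iterZ.
Qed.

Let good_all x : x \in Z -> good x.
Proof.
move=> Zx; have [k xk] := sqr_trivial Zx; have := good1; rewrite -xk.
elim: k {xk} => // k IH; rewrite iterS => h; apply: IH; apply: good_down h.
exact: iterZ.
Qed.

Lemma char_span_generation c : C 1 c -> V c.
Proof.
move=> [l [lE l1 cE]]; apply: approxV; rewrite (funext cE).
have z : approx (fun=> 0).
  apply: approxW; first exact: char_span0.
  have := Vsq (char_span0 ler01); congr V.
  by apply/funext => i; rewrite expr0n addr0.
elim: (index_enum _) => [|x s IH].
  by move: z; congr approx; apply/funext => i; rewrite big_nil.
case Zx: (x \in Z); last first.
  by move: IH; congr approx; apply/funext => i; rewrite big_cons Zx.
have := approxD (good_all Zx (lE x) (l1 x)) IH; congr approx.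
by apply/funext => i; rewrite big_cons Zx.
Qed.

End Generation.
End Fixed.
End CharacterSpan.

(** * Irreducible representations and the group ring *)

Section Irreducible.

Variables (F : fieldType) (gT : finGroupType) (G : {group gT}).

(** Schur's lemma over a field that need not be algebraically closed: if [T x] were not scalar,
    every [T x - w] would be a nonzero, hence invertible, endomorphism, while their product over the
    roots [w] is 0. *)
Lemma irr_eigenvalue n (T : mx_representation F G n) x m (r : seq F) :
  mx_irreducible T -> x \in G -> (x ^+ m = 1)%g ->
  'X^m - 1 = \prod_(w <- r) ('X - w%:P) ->
  {in G, forall y, T x *m T y = T y *m T x} -> exists w, T x = w%:M.
Proof.
case: n T => [|n] T irrT Gx xm Xm cTx.
  by case/mx_irrP: irrT.
apply: contrapT => nsc.
have U s : \prod_(w <- s) (T x - w%:M) \in unitmx.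
  elim: s => [|w s IH]; first by rewrite big_nil unitmx1.
  rewrite big_cons unitmx_mul IH andbT; apply: (mx_Schur irrT).
    apply/centgmxP => y Gy; rewrite mulmxBl mulmxBr cTx //.
    by rewrite scalar_mxC.
  by rewrite subr_eq0; apply/eqP => e; apply: nsc; exists w.
have := U r; have -> : \prod_(w <- r) (T x - w%:M) = 0.
  have := congr1 (horner_mx (T x)) Xm.
  rewrite rmorph_prod rmorphB rmorphXn /= horner_mx_X rmorph1 -repr_mxX // xm.
  rewrite repr_mx1 subrr => h; rewrite [RHS]h; apply: eq_bigr => w _.
  by rewrite rmorphB /= horner_mx_X horner_mx_C.
by rewrite unitmxE det0 unitr0.
Qed.

Lemma irr_scalar_degree1 n (T : mx_representation F G n) :
  mx_irreducible T -> (forall x, x \in G -> exists w, T x = w%:M) -> n = 1%N.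
Proof.
case/mx_irrP=> n0 irrT scT; case: n n0 T irrT scT => // n _ T irrT scT.
have modU : mxmodule T (delta_mx 0 0 : 'M_n.+1).
  apply/mxmoduleP => x Gx; have [w ->] := scT x Gx.
  by rewrite mul_mx_scalar scalemx_sub.
have := irrT _ modU; rewrite /row_full mxrank_delta.
have -> : (delta_mx 0 0 != 0 :> 'M[F]_n.+1).
  apply/eqP => /matrixP/(_ 0 0); rewrite !mxE !eqxx => /eqP.
  by rewrite oner_eq0.
by move/(_ isT)/eqP=> <-.
Qed.

Hypothesis G'F : ([pchar F]^'.-group G)%g.

(** Induction on the degree, splitting off a simple submodule by Maschke's theorem. *)
Lemma repr_irr_ind (P : representation F G -> Prop) :
  (forall A B, rsim A B -> P A -> P B) ->
  (forall A B, P A -> P B -> P (dadd_grepr A B)) -> P (@grepr0 F gT G) ->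
  (forall A : representation F G, mx_irreducible A -> P A) -> forall A, P A.
Proof.
move=> Prsim Padd P0 Pirr A.
have [n] := ubnP (rdegree A); elim: n A => // n IH [[|d] A] /= dn.
  apply: Prsim P0; apply: (@cast_rsim _ _ _ (@grepr0 F gT G) (Representation A) erefl).
  by move=> x _; rewrite castmx_id; apply/matrixP => -[].
have nz1 : (1%:M : 'M[F]_d.+1) != 0 by exact: oner_neq0.
(* [mxsimple_exists] gives the submodule only [classically]; at [false] this is a double
   negation. *)
have [U simU _] : exists2 U, mxsimple A U & (U <= (1%:M : 'M_d.+1))%MS.
  apply: contrapT => H; have /(_ false) h := mxsimple_exists (mxmodule1 A) nz1.
  by suff : false by []; apply: h => h; case: H.
have [modU nzU _] := simU.
have [W modW defUW dxUW] := mx_Maschke_pchar A G'F modU (submx1 U).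
have rUW : (\rank U + \rank W)%N = d.+1.
  by rewrite -(mxdirectP dxUW) defUW mxrank1.
apply: (Prsim (dadd_grepr (Representation (submod_repr modU))
   (Representation (submod_repr modW)))).
  apply: (@rsim_trans _ _ _ _ (Representation (submod_repr (mxmodule1 A)))); last first.
    exact: rsim_submod1 (eqmx_refl _).
  by apply: rsim_sym; apply: mx_rsim_dadd defUW dxUW _ _; exact: mx_rsim_refl.
apply: Padd; first by apply: Pirr; apply/submod_mx_irr.
by apply: IH => /=; move: rUW dn nzU; rewrite -mxrank_eq0; lia.
Qed.

Lemma gring_op_dadd (A B : representation F G) x : (x \in group_ring F G)%MS ->
  gring_op (dadd_grepr A B) x = block_mx (gring_op A x) 0 0 (gring_op B x).
Proof.
case/envelop_mxP=> l ->; rewrite !linear_sum /=.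
elim/big_rec3: _ => [|g X Y Z Gg ->]; first by rewrite block_mx_const.
by rewrite !linearZ /= !gring_opG //= scale_block_mx add_block_mx !scaler0 !addr0.
Qed.

Lemma gring_op_sum (A : representation F G) (l : gT -> F) :
  gring_op A (\sum_(g in G) l g *: regular_repr F G g) = \sum_(g in G) l g *: A g.
Proof.
by rewrite linear_sum; apply: eq_bigr => g Gg; rewrite linearZ /= gring_opG.
Qed.

Lemma gring_sum_mem (l : gT -> F) :
  (\sum_(g in G) l g *: regular_repr F G g \in group_ring F G)%MS.
Proof. by apply/envelop_mxP; exists l. Qed.

Lemma gring_coef_eq0 (l : gT -> F) : 
  \sum_(g in G) l g *: regular_repr F G g = 0 -> {in G, forall g, l g = 0}.
Proof.
move=> l0 g Gg; have := congr1 (fun M => gring_proj g M 0 0) l0.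
rewrite linear_sum summxE linear0 mxE (bigD1 g) //= big1 => [|h /andP[Gh hg]].
  by rewrite linearZ /= gring_projE // eqxx !mxE mulr1 addr0.
by rewrite linearZ /= gring_projE // eq_sym (negPf hg) !mxE mulr0.
Qed.

(** By complete reducibility the sum also vanishes in the regular representation, where the group
    elements are linearly independent. *)
Lemma irr_gring_coef_eq0 (l : gT -> F) :
  (forall A : representation F G, mx_irreducible A ->
     \sum_(g in G) l g *: A g = 0) ->
  {in G, forall g, l g = 0}.
Proof.
move=> l0; apply: gring_coef_eq0; rewrite -[LHS]gring_op_id ?gring_sum_mem //.
pose P (A : representation F G) := \sum_(g in G) l g *: A g = 0.
suff h : P (Representation (regular_repr F G)).
  by rewrite (gring_op_sum (Representation (regular_repr F G))).
apply: (@repr_irr_ind P) => // [A B [M nAB /row_freeP[M' MM'] hM] A0|A B A0 B0|].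
- rewrite /P; suff : M *m (\sum_(g in G) l g *: B g) = 0.
    case: A B M nAB M' MM' hM A0 => n A [n' B] /= M nAB.
    case: n' / nAB B M => B M M' MM' _ _ /(congr1 (mulmx M')).
    by rewrite mulmxA (mulmx1C MM') mul1mx mulmx0.
  rewrite mulmx_sumr.
  under eq_bigr => g Gg do rewrite -scalemxAr -hM // scalemxAl.
  by rewrite -mulmx_suml A0 mul0mx.
- rewrite /P -gring_op_sum gring_op_dadd ?gring_sum_mem // !gring_op_sum.
  by rewrite A0 B0 block_mx_const.
by apply/matrixP => -[].
Qed.

Lemma map_repr_irr (s t : {rmorphism F -> F}) (A : representation F G) :
  cancel s t -> mx_irreducible A -> mx_irreducible (grepr_map s A).
Proof.
move=> st irrA; apply: (@mx_irr_map _ _ t).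
apply: mx_rsim_irr irrA; apply: MxReprSim (1%:M) _ _ _ => // [|x Gx].
  by rewrite row_free_unit unitmx1.
rewrite mulmx1 mul1mx; apply/matrixP => i j.
by rewrite !mxE st.
Qed.

End Irreducible.

(** * Groups with commutator subgroup of order 2 *)

Section ClassTwo.

Variables (gT : finGroupType) (G : {group gT}) (z : gT).
Hypothesis hG : (2.-group G)%g.
Hypothesis hz_central : z \in 'Z(G)%g.
Hypothesis hz_order : #[z]%g = 2%N.
Hypothesis hz_comm : exists x y : gT, [/\ x \in G, y \in G & z = [~ x, y]%g].
Hypothesis hG_ab : abelian (G / <[z]>)%g.

Lemma z_in : z \in G.
Proof. by have /setIP[] := hz_central. Qed.

Lemma z_neq1 : z != 1%g.
Proof. by rewrite -order_eq1 hz_order. Qed.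

Lemma z_sqr : (z * z = 1)%g.
Proof. by have := expg_order z; rewrite hz_order expgS expg1. Qed.

Lemma z_commute g : g \in G -> (z * g = g * z)%g.
Proof. by move=> Gg; have /setIP[_ /centP/(_ g Gg)] := hz_central. Qed.

Lemma z_mulK g : (z * (z * g) = g)%g.
Proof. by rewrite mulgA z_sqr mul1g. Qed.

Lemma z_mul_in g : (z * g \in G)%g = (g \in G).
Proof. by rewrite groupMl // z_in. Qed.

Lemma z_mulZ_in g : (z * g \in 'Z(G))%g = (g \in 'Z(G))%g.
Proof. by rewrite groupMl. Qed.

Lemma conj_by_z x y : x \in G -> y \in G -> (x ^ y = x)%g \/ (x ^ y = x * z)%g.
Proof.
move=> Gx Gy; have nzG : G \subset 'N(<[z]>)%g.
  by rewrite cents_norm // centsC cycle_subG; have /setIP[] := hz_central.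
have /subsetP/(_ [~ x, y]%g) := der1_min nzG hG_ab.
rewrite derg1 mem_commg // => /(_ isT) /cyclePmin[i].
rewrite hz_order; case: i => [|[|//]] _ e.
  by left; rewrite conjg_mulR e expg0 mulg1.
by right; rewrite conjg_mulR e expg1.
Qed.

Lemma noncentral_conj x : x \in G -> x \notin 'Z(G)%g ->
  exists2 y, y \in G & (x ^ y = x * z)%g.
Proof.
move=> Gx Zx; apply: contrapT => H; move/negP: Zx; apply.
apply/setIP; split=> //; apply/centP => y Gy.
have [e|e] := conj_by_z Gx Gy; last by case: H; exists y.
by apply/commgP/conjg_fixP.
Qed.

Lemma sqr_central x : x \in G -> (x ^+ 2 \in 'Z(G))%g.
Proof.
move=> Gx; apply/setIP; split; first exact: groupX.
apply/centP => y Gy; apply/commgP; apply/conjg_fixP; rewrite conjXg.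
have [->|->] // := conj_by_z Gx Gy.
rewrite expgMn; first by rewrite -hz_order expg_order mulg1.
by rewrite /commute z_commute.
Qed.

Lemma exists_noncentral : exists2 x, x \in G & x \notin 'Z(G)%g.
Proof.
have [x [y [Gx Gy zE]]] := hz_comm; exists x => //.
apply/negP => /setIP[_ /centP/(_ y Gy)] /commgP/eqP e.
by have := z_neq1; rewrite zE e eqxx.
Qed.

(* Exactly one of [g] and [z g] is selected. *)
Definition half (g : gT) := (enum_rank g < enum_rank (z * g)%g)%N.

Lemma halfE g : half (z * g) = ~~ half g.
Proof.
have ne : (z * g != g)%g.
  apply: contraNneq z_neq1 => e; apply/eqP.
  by rewrite -[LHS](mulgK g) e mulgV.
have : enum_rank (z * g)%g != enum_rank g :> nat.
  by rewrite (inj_eq val_inj) (inj_eq enum_rank_inj).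
by rewrite /half z_mulK; move: (enum_rank _ : nat) (enum_rank _ : nat); clear => p q; lia.
Qed.

(** * Irreducible representations of [G] in characteristic 0 with enough roots of unity *)

Variables (F : fieldType).
Hypothesis charF : [pchar F] =i pred0.
Hypothesis hroots : exists r : seq F, 'X^#|G| - 1 = \prod_(w <- r) ('X - w%:P).
Implicit Types T : representation F G.

Let natF n : (0 < n)%N -> n%:R != 0 :> F.
Proof. by move=> n0; have /pcharf0P -> := charF; rewrite -lt0n. Qed.

Lemma pgroup_char0 (H : {group gT}) : ([pchar F]^'.-group H)%g.
Proof. by apply/pgroupP => p _ _; rewrite inE /= charF. Qed.

Lemma irr_rdegree_gt0 T : mx_irreducible T -> (0 < rdegree T)%N.
Proof. by case/mx_irrP. Qed.

(** For irreducible [T] and central [x] this is the scalar by which [x] acts. The normalized trace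
    needs no choice of an eigenvalue and commutes with field automorphisms. *)
Definition central_char T x : F := \tr (T x) / (rdegree T)%:R.

Lemma central_charE T x : mx_irreducible T -> x \in 'Z(G)%g ->
  T x = (central_char T x)%:M.
Proof.
move=> irrT /setIP[Gx cGx]; have [r hr] := hroots.
have [|y Gy|w Tx] := irr_eigenvalue irrT Gx _ hr.
- by apply/eqP; rewrite -order_dvdn order_dvdG.
- by rewrite -!repr_mxM // (centP cGx).
rewrite /central_char Tx mxtrace_scalar -[w *+ _]mulr_natr mulfK //.
by rewrite natF // irr_rdegree_gt0.
Qed.

Lemma scalar_mx_inj_gt0 n (c d : F) : (0 < n)%N -> c%:M = d%:M :> 'M_n -> c = d.
Proof.
by case: n => // n _ /matrixP/(_ 0 0); rewrite !mxE eqxx !mulr1n.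
Qed.

Lemma central_char1 T : mx_irreducible T -> central_char T 1%g = 1.
Proof.
move=> irrT; apply: (scalar_mx_inj_gt0 (irr_rdegree_gt0 irrT)).
by rewrite -central_charE ?group1 // repr_mx1.
Qed.

Lemma central_charM T : mx_irreducible T ->
  {in 'Z(G)%g &, {morph central_char T : x y / (x * y)%g >-> x * y}}.
Proof.
move=> irrT x y Zx Zy /=; apply: (scalar_mx_inj_gt0 (irr_rdegree_gt0 irrT)).
rewrite -central_charE ?groupM // repr_mxM ?(subsetP (center_sub G)) //.
by rewrite !central_charE // -scalar_mxM.
Qed.

Lemma irr_z T : mx_irreducible T -> T z = 1%:M \/ T z = (-1)%:M.
Proof.
move=> irrT; have e := central_charE irrT hz_central.
have : central_char T z ^+ 2 = 1.
  by rewrite expr2 -central_charM // z_sqr central_char1.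
move/eqP; rewrite sqrf_eq1 => /orP[] /eqP c; rewrite e c; [by left|by right].
Qed.

(** [T] factors through the abelian quotient by [z], so all its matrices commute and are scalar. *)
Lemma irr_linear T : mx_irreducible T -> T z = 1%:M -> rdegree T = 1%N.
Proof.
move=> irrT Tz; apply: irr_scalar_degree1 (irrT) _ => x Gx.
have [r hr] := hroots; apply: irr_eigenvalue (irrT) (Gx) _ hr _.
  by apply/eqP; rewrite -order_dvdn order_dvdG.
move=> y Gy; rewrite -!repr_mxM //.
have -> : (x * y = y * x ^ y)%g by rewrite conjgC.
have [->|->] // := conj_by_z Gx Gy.
by rewrite mulgA (repr_mxM T (groupM Gy Gx) z_in) Tz mulmx1.
Qed.

(** Faithfulness is meant on [<[z]>] only; by [irr_z] these are the irreducible representations on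
    which [z] is nontrivial. *)
Definition faithful_irr T := mx_irreducible T /\ T z = (-1)%:M.

Lemma faithful_conj T x y : faithful_irr T -> x \in G -> y \in G ->
  (x ^ y = x * z)%g -> T x *m T y = - (T y *m T x).
Proof.
move=> [_ Tz] Gx Gy e; rewrite -!repr_mxM // conjgC e mulgA.
by rewrite (repr_mxM T (groupM Gy Gx) z_in) Tz mul_mx_scalar scaleN1r.
Qed.

(** [T x] is conjugate to [- T x], and 2 is nonzero. *)
Lemma faithful_trace0 T x : faithful_irr T -> x \in G -> x \notin 'Z(G)%g ->
  \tr (T x) = 0.
Proof.
move=> fT Gx Zx; have [y Gy e] := noncentral_conj Gx Zx.
have : \tr (T x) = - \tr (T x).
  have {1}-> : T x = T x *m T y *m T y^-1%g.
    by rewrite -!repr_mxM ?groupV ?groupM // mulgK.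
  rewrite (faithful_conj fT Gx Gy e) mulNmx linearN /= mxtrace_mulC mulmxA.
  by rewrite -!repr_mxM ?groupM ?groupVr // mulVg mul1g.
move/eqP; rewrite -addr_eq0 -mulr2n -mulr_natr mulf_eq0.
by rewrite (negPf (natF _)) // orbF => /eqP.
Qed.

Lemma common_eigenvector (A : {group gT}) n (T : mx_representation F A n) :
  abelian A -> A \subset G -> (0 < n)%N ->
  exists2 v : 'rV_n, v != 0 & exists chi : gT -> F,
    forall x, x \in A -> v *m T x = chi x *: v.
Proof.
move=> cAA sAG; case: n T => // n T _.
have nz1 : (1%:M : 'M[F]_n.+1) != 0 by exact: oner_neq0.
have [U simU _] : exists2 U, mxsimple T U & (U <= (1%:M : 'M_n.+1))%MS.
  apply: contrapT => H; have /(_ false) h := mxsimple_exists (mxmodule1 T) nz1.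
  by suff : false by []; apply: h => h; case: H.
have [modU nzU _] := simU; exists (nz_row U); first by rewrite nz_row_eq0.
have irrU : mx_irreducible (submod_repr modU) by apply/submod_mx_irr.
have [r hr] := hroots.
have sc x : exists w, x \in A -> submod_repr modU x = w%:M.
  case Ax: (x \in A); last by exists 0.
  have [|y Ay|w e] := irr_eigenvalue irrU Ax _ hr.
  - by apply/eqP; rewrite -order_dvdn order_dvdG // (subsetP sAG).
  - by rewrite -!repr_mxM // (centsP cAA x Ax y Ay).
  by exists w.
have [chi chiE] := choice sc; exists chi => x Ax.
have vU := nz_row_sub U; rewrite -{1}(in_submodK vU) -(val_submodJ modU) //.
have /= -> := chiE x Ax.
by rewrite mul_mx_scalar linearZ /= in_submodK.
Qed.

(* The sum of [chi (a^-1) T a] over [A] has trace [|Z| * degree], because [T]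
   has trace 0 off the centre; it also has rank 1 with eigenvalue [|A|], because
   the conjugates of [chi] by elements outside [A = 'C_G(A)] differ from [chi]. *)
Lemma faithful_degree (A : {group gT}) T : A \in 'SCN(G)%g -> faithful_irr T ->
  (#|'Z(G)%g| * rdegree T = #|A|)%N.
Proof.
move=> SCN_A fT; have cAA := SCN_abelian SCN_A.
have /SCN_P[/andP[sAG nAG] cA] := SCN_A; have [irrT Tz] := fT.
have sZA : 'Z(G)%g \subset A by rewrite -cA setIS // centS.
have n0 := irr_rdegree_gt0 irrT.
have [v nzv [chi chiE]] := common_eigenvector (subg_repr T sAG) cAA sAG n0.
have Av g : g \in A -> g \in G by apply: (subsetP sAG).
have vinj c d : c *: v = d *: v -> c = d.
  by move/eqP; rewrite -subr_eq0 -scalerBl scaler_eq0 (negPf nzv) orbF subr_eq0 => /eqP.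
have chiM x y : x \in A -> y \in A -> chi (x * y)%g = chi x * chi y.
  move=> Ax Ay; apply: vinj; rewrite -chiE ?groupM //= repr_mxM ?Av //.
  by rewrite mulmxA chiE // -scalemxAl chiE // scalerA mulrC.
have chi1 : chi 1%g = 1 by apply: vinj; rewrite -chiE // repr_mx1 mulmx1 scale1r.
have chiZ x : x \in 'Z(G)%g -> chi x = central_char T x.
  move=> Zx; apply: vinj; rewrite -chiE ?(subsetP sZA) //= central_charE //.
  by rewrite mul_mx_scalar.
have chiz : chi z = -1.
  by apply: vinj; rewrite -chiE ?(subsetP sZA) //= Tz mul_mx_scalar.
have chiV x : x \in A -> chi x^-1%g * chi x = 1.
  by move=> Ax; rewrite -chiM ?groupV // mulVg.
pose e := \sum_(x in A) chi x^-1%g *: T x.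
have tr1 : \tr e = (#|'Z(G)%g| * rdegree T)%:R.
  rewrite linear_sum /= (bigID (mem 'Z(G)%g)) /= [X in _ + X]big1 ?addr0.
    transitivity (\sum_(x in 'Z(G)%g) (rdegree T)%:R : F).
      apply: eq_big => [x|x /andP[Ax Zx]].
        exact: andb_idl (subsetP sZA x).
      rewrite linearZ /= central_charE // mxtrace_scalar -chiZ // mulrnAr.
      by rewrite chiV.
    by rewrite sumr_const natrM mulr_natl.
  move=> x /andP[Ax Zx]; rewrite linearZ /= faithful_trace0 ?mulr0 //.
  exact: Av.
have vTe g : g \in G -> v *m T g *m e =
    (\sum_(x in A) chi x^-1%g * chi (x ^ g^-1)%g) *: (v *m T g).
  move=> Gg; rewrite mulmx_sumr scaler_suml; apply: eq_bigr => x Ax.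
  rewrite -scalemxAr -mulmxA -repr_mxM ?(Av x Ax) // -scalerA; congr (_ *: _).
  have -> : (g * x = x ^ g^-1 * g)%g by rewrite conjgE invgK !mulgA mulgKV.
  have Axg : (x ^ g^-1 \in A)%g by rewrite memJ_norm // groupV (subsetP nAG).
  rewrite repr_mxM ?(Av _ Axg) // mulmxA scalemxAl; congr (_ *m _).
  by have /= -> := chiE _ Axg.
have ve : v *m e = #|A|%:R *: v.
  have := vTe 1%g (group1 G); rewrite repr_mx1 mulmx1 => ->; congr (_ *: _).
  rewrite -sum1_card natr_sum; apply: eq_bigr => x Ax.
  by rewrite invg1 conjg1 chiV.
have vTe_sub g : g \in G -> (v *m T g *m e <= v)%MS.
  move=> Gg; case Ag: (g \in A).
    have /= -> := chiE g Ag; rewrite -scalemxAl ve scalerA.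
    exact: scalemx_sub.
  rewrite vTe //; set s := \sum_(x in A) _.
  (* As [A] is its own centralizer, [g] moves some [y] in [A], necessarily to [y * z]. Substituting
     [y * x] for [x] then multiplies [s] by [chi z = -1]. *)
  have [y Ay yg] : exists2 y, y \in A & (y ^ g^-1 = y * z)%g.
    apply: contrapT => H; move/negP: Ag; apply; rewrite -cA.
    apply/setIP; split=> //; apply/centP => y Ay; apply: commute_sym.
    apply/commgP/conjg_fixP.
    have [h|h] := conj_by_z (Av y Ay) (groupVr Gg); last by case: H; exists y.
    by rewrite -[in LHS]h conjgKV.
  suff -> : s = 0 by rewrite scale0r sub0mx.
  have : s = - s.
    rewrite {1}/s (reindex_inj (mulgI y)) /= -sumrN.
    apply: eq_big => [x|x]; first by rewrite groupMl.
    rewrite groupMl // => Ax; rewrite conjMg yg invMg.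
    have Axg : (x ^ g^-1 \in A)%g by rewrite memJ_norm // groupV (subsetP nAG).
    have Az : z \in A by exact: (subsetP sZA).
    rewrite (chiM _ _ (groupVr Ax) (groupVr Ay)) (chiM _ _ (groupM Ay Az) Axg).
    rewrite (chiM _ _ Ay Az) chiz mulrN1 mulNr mulrN; congr (- _).
    by rewrite -mulrA [chi y^-1%g * _]mulrA chiV // mul1r.
  move/eqP; rewrite -addr_eq0 -mulr2n -mulr_natr mulf_eq0.
  by rewrite (negPf (natF _)) // orbF => /eqP.
(* By irreducibility the translates of [v] span the whole space, and [e] sends each into the line of
   [v]. Thus [e = c *m v], whose trace [v *m c] is the eigenvalue of [e] on [v]. *)
clearbody e; have esub : (e <= v)%MS.
  have full : row_full (cyclic_mx T v).
    by case/mx_irrP: irrT => _; apply; rewrite ?cyclic_mx_module ?cyclic_mx_eq0.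
  have full1 : (1%:M <= cyclic_mx T v)%MS by rewrite sub1mx.
  rewrite -[e]mul1mx; apply: submx_trans (submxMr e full1) _.
  apply/row_subP => i; rewrite row_mul.
  have /cyclic_mxP[B /envelop_mxP[b ->] ->] := row_sub i (cyclic_mx T v).
  rewrite mulmx_sumr mulmx_suml summx_sub // => g Gg.
  by rewrite -scalemxAr -scalemxAl scalemx_sub // vTe_sub.
have /submxP[c ec] := esub.
have tr2 : \tr e = #|A|%:R.
  rewrite ec mxtrace_mulC [v *m c]mx11_scalar mxtrace_scalar.
  apply: vinj; rewrite -ve ec mulmxA [v *m c in RHS]mx11_scalar.
  by rewrite mul_scalar_mx.
have := tr1; rewrite tr2 => /eqP; rewrite eq_sym => /eqP nn.
have inj (p q : nat) : (p <= q)%N -> p%:R = q%:R :> F -> p = q.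
  move=> pq e0; apply/eqP; rewrite eqn_leq pq /= -subn_eq0.
  by have /pcharf0P <- := charF; rewrite natrB // e0 subrr.
by have [le|/ltnW le] := leqP (#|'Z(G)%g| * rdegree T) #|A|; [|symmetry]; apply: inj.
Qed.

(** The degree is the index of the centre in a maximal normal abelian subgroup [A]. The index
    exceeds 1: if [A] were the centre, its centralizer would be all of [G], not [A]. *)
Lemma faithful_degree_pow2 : exists2 m, (0 < m)%N &
  forall T, faithful_irr T -> rdegree T = (2 ^ m)%N.
Proof.
have [A maxA _] := @maxgroup_exists gT
  (fun A => (A <| G)%g && abelian A) 1%G (introT andP (conj (normal1 G) (abelian1 gT))).
have SCN_A := max_SCN hG maxA; have /SCN_P[/andP[sAG nAG] cA] := SCN_A.
have sZA : 'Z(G)%g \subset A by rewrite -cA setIS // centS.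
have AneZ : 'Z(G)%g != A :> {set gT}.
  apply/eqP => ZA; have [x Gx /negP[]] := exists_noncentral.
  rewrite ZA -cA -[in X in _ :&: X]ZA; apply/setIP; split=> //; apply/centP => y.
  by case/setIP=> _ /centP/(_ x Gx); exact: commute_sym.
have dvdA : (#|A : 'Z(G)|%g %| #|G|)%N.
  exact: dvdn_trans (dvdn_indexg _ _) (cardSg sAG).
have [m mE] := p_natP (pnat_dvd dvdA hG); exists m.
  by rewrite lt0n; apply/eqP => m0; move: AneZ; rewrite eqEsubset sZA /= -indexg_eq1 mE m0.
move=> T fT; have := faithful_degree SCN_A fT; rewrite -(Lagrange sZA) -mE.
by move/eqP; rewrite eqn_pmul2l ?cardG_gt0 // => /eqP.
Qed.

(** Conjugation by [T y] turns [T x] into [- T x], so [P = det (1 + t T x)] equals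
    [det (1 - t T x)]. Their product is [det (1 - t^2 T (x^2))] with [x^2] central, which gives
    [P^2]; the value at [t = 0] fixes the sign of the root. *)
Lemma faithful_det T x c m : faithful_irr T -> rdegree T = (2 ^ m.+1)%N ->
  x \in G -> x \notin 'Z(G)%g ->
  \det (1%:M + c *: T x) = (1 - c ^+ 2 * central_char T (x ^+ 2)%g) ^+ (2 ^ m).
Proof.
move=> fT dT Gx Zx; have [irrT _] := fT; set lam := central_char T _.
pose V := map_mx polyC (T x); pose P := det_pencil (T x).
have [y Gy e] := noncentral_conj Gx Zx.
have detV : \det (1%:M - 'X *: V) = P.
  pose B := map_mx polyC (T y).
  have nzB : \det B != 0.
    rewrite det_map_mx polyC_eq0 -unitfE -unitmxE.
    exact: repr_mx_unit.
  have conj : (1%:M + 'X *: V) *m B = B *m (1%:M - 'X *: V).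
    rewrite mulmxDl mulmxBr mul1mx mulmx1 -scalemxAl -scalemxAr -!map_mxM.
    by rewrite (faithful_conj fT Gx Gy e) map_mxN scalerN.
  by apply: (mulfI nzB); rewrite -det_mulmx -conj det_mulmx mulrC.
pose S := 1 - lam *: 'X^2 : {poly F}.
have PP : P ^+ 2 = (S ^+ (2 ^ m)) ^+ 2.
  rewrite -exprM -expnSr -dT -[S ^+ _]det_scalar expr2 -{2}detV -det_mulmx.
  congr (\det _); pose U := 'X *: V; rewrite -/U -/V -/U.
  rewrite mulmxDl mul1mx mulmxBr mulmx1 addrA subrK.
  rewrite -scalemxAl -scalemxAr scalerA -expr2 -map_mxM -repr_mxM //.
  rewrite -[(x * x)%g]/(x ^+ 2)%g central_charE ?sqr_central // map_scalar_mx.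
  by rewrite scale_scalar_mx -(raddfB (@scalar_mx _ _)) /= mulrC mul_polyC.
have PS : P = S ^+ (2 ^ m).
  have /eqP := PP; rewrite eqf_sqr => /orP[/eqP //|/eqP PN].
  have := congr1 (fun p => p.[0]) PN; rewrite horner_det_pencil scale0r addr0 det1.
  rewrite hornerN horner_exp !hornerE /= ?expr0n ?mulr0 ?subr0 ?expr1n => /eqP.
  rewrite -addr_eq0 -[1 + 1](natrD _ 1 1).
  by rewrite (negPf (natF _)).
rewrite -horner_det_pencil -/P PS horner_exp !hornerE /=.
by rewrite -mulrA [lam * _]mulrC -/lam -expr2 mulrA.
Qed.

End ClassTwo.

(** * Units of integral group rings *)

Section Units.

Variables (R : realType) (F : fieldType) (N : splittingFieldType F).
Variables (a : nonarch_abs R N) (gT : finGroupType) (G : {group gT}).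
Implicit Types (E : {subfield N}).
Local Notation aG := (regular_repr N G).

Lemma det_val_ring E n (A : 'M[N]_n) :
  (forall i j, A i j \in val_ring a E) -> \det A \in val_ring a E.
Proof.
move=> AE; rewrite inE; apply/andP; split.
  apply: rpred_sum => s _; rewrite rpredM ?rpredX ?rpredN ?rpred1 //.
  by apply: rpred_prod => i _; have /andP[] := AE i (s i).
rewrite -[X in _ <= X](expr1n _ n); apply: abs_det_le => // i j.
by have /andP[] := AE i j.
Qed.

Lemma abs_prod_dist (I : Type) (r : seq I) (f g : I -> N) (s : R) : 0 <= s ->
  (forall i, a (f i) <= 1) -> (forall i, a (g i) <= 1) ->
  (forall i, a (f i - g i) <= s) ->
  a (\prod_(i <- r) f i - \prod_(i <- r) g i) <= s.
Proof.
move=> s0 f1 g1 fg; elim: r => [|i r IH]; first by rewrite !big_nil subrr abs0.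
rewrite !big_cons.
set p := \prod_(j <- r) f j in IH *; set q := \prod_(j <- r) g j in IH *.
have -> : f i * p - g i * q = (f i - g i) * p + g i * (p - q) by ring.
have p1 : a p <= 1 by rewrite -[X in _ <= X](expr1n _ (size r)); exact: abs_prod_le.
apply: absD_le; rewrite absM.
  by apply: le_trans (fg i); rewrite ler_piMr ?abs_ge0.
by apply: le_trans IH; rewrite ler_piMl ?abs_ge0.
Qed.

Lemma abs_det_dist n (A B : 'M[N]_n) (s : R) : 0 <= s ->
  (forall i j, a (A i j) <= 1) -> (forall i j, a (B i j) <= 1) ->
  (forall i j, a (A i j - B i j) <= s) -> a (\det A - \det B) <= s.
Proof.
move=> s0 A1 B1 AB; rewrite -sumrB; apply: abs_sum_le => // p _.
by rewrite -mulrBr absM absX absN1 expr1n mul1r abs_prod_dist.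
Qed.

Lemma int_gringD E u v : int_gring a E u -> int_gring a E v ->
  int_gring a E (u + v : 'M[N]_#|G|).
Proof.
move=> [l lE ->] [m mE ->]; exists (fun g => l g + m g) => [g|].
  have /andP[Elg l1] := lE g; have /andP[Emg m1] := mE g.
  by rewrite inE rpredD //=; apply: absD_le.
by rewrite -big_split; apply: eq_bigr => g _; rewrite /= scalerDl.
Qed.

Lemma int_gringN E u : int_gring a E u -> int_gring a E (- u : 'M[N]_#|G|).
Proof.
move=> [l lE ->]; exists (fun g => - l g) => [g|].
  by have := lE g; rewrite !inE rpredN absN.
by rewrite -sumrN; apply: eq_bigr => g _; rewrite scaleNr.
Qed.

Lemma int_gringB E u v : int_gring a E u -> int_gring a E v ->
  int_gring a E (u - v : 'M[N]_#|G|).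
Proof. by move=> uE vE; apply: int_gringD => //; exact: int_gringN. Qed.

Lemma int_gring_group E g : g \in G -> int_gring a E (aG g).
Proof.
move=> Gg; exists (fun h => (h == g)%:R) => [h|].
  by case: eqP => _; [exact: val_ring1|exact: val_ring0].
rewrite (bigD1 g) //= eqxx scale1r big1 ?addr0 // => h /andP[_ /negPf->].
by rewrite scale0r.
Qed.

Lemma int_gring_entry E (u : 'M[N]_#|G|) i j : int_gring a E u ->
  u i j \in val_ring a E.
Proof.
move=> [l lE ->]; rewrite summxE; apply: val_ring_sum => g _.
rewrite !mxE; apply: val_ringM => //.
by case: (_ && _); [exact: val_ring1|exact: val_ring0].
Qed.

(* The inverse has integral entries by Cramer's rule, and the first row of a
   matrix of the regular representation lists the coefficients. *)
Lemma int_gring_unit_det E (u : 'M[N]_#|G|) : int_gring a E u -> a (\det u) = 1 ->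
  int_gring_unit_spec a E u.
Proof.
move=> uE du; have u0 : \det u != 0 by rewrite -(abs_eq0 a) du oner_eq0.
have Uu : u \in unitmx by rewrite unitmxE unitfE.
have dE : \det u \in val_ring a E.
  by apply: det_val_ring => i j; exact: int_gring_entry.
have entry i j : invmx u i j \in val_ring a E.
  rewrite /invmx Uu !mxE; apply: val_ringM.
    have /andP[dE' _] := dE.
    by rewrite inE rpredV dE' absV du invr1 /=.
  apply: val_ringM.
    by rewrite inE rpredX ?rpredN ?rpred1 //= absX absN1 expr1n.
  by apply: det_val_ring => k l; rewrite !mxE; exact: int_gring_entry.
(* It is not yet known that the inverse lies in the group ring. [v] is the element of the group ring
   with the same row at the identity, and such elements are determined by this row. *)
pose v := gring_mx aG (gring_row (invmx u)).
have vR : (v \in group_ring N G)%MS by exact: gring_mxP.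
have uR := int_gring_mem uE.
have vu : v *m u = 1%:M.
  rewrite -[LHS]gring_rowK ?envelop_mxM // gring_row_mul gring_mxK.
  by rewrite -gring_row_mul mulVmx // gring_rowK // envelop_mx1.
have vE : v = invmx u by rewrite -[v](mulmxK Uu) vu mul1mx.
split=> //; exists v; last by rewrite vu vE mulmxV.
exists (fun g => if g \in G then invmx u (gring_index G 1) (gring_index G g) else 0).
  by move=> g; case: ifP => _ //; exact: val_ring0.
have /envelop_mxP[l lE] := vR; rewrite lE; apply: eq_bigr => g Gg.
rewrite Gg; congr (_ *: _).
have : gring_proj g v 0 0 = l g.
  rewrite lE linear_sum summxE (bigD1 g) //= big1 => [|h /andP[Gh hg]].
    by rewrite linearZ /= gring_projE // eqxx !mxE mulr1 addr0.
  by rewrite linearZ /= gring_projE // eq_sym (negPf hg) !mxE mulr0.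
by move<-; rewrite vE /gring_proj /= !mxE.
Qed.

Variable z : gT.
Hypothesis Gz : z \in G.
Hypothesis cz : forall g, g \in G -> (z * g = g * z)%g.
Hypothesis z2 : (z * z = 1)%g.
Hypothesis a2 : a 2%:R < 1.

Definition one_plus (x : 'M[N]_#|G|) : 'M[N]_#|G| := 1%:M + (x - aG z *m x).

Lemma gring_z_commute x : (x \in group_ring N G)%MS -> aG z *m x = x *m aG z.
Proof.
case/envelop_mxP=> l ->; rewrite mulmx_sumr mulmx_suml; apply: eq_bigr => g Gg.
by rewrite -scalemxAl -scalemxAr -!repr_mxM // cz.
Qed.

Lemma int_gring_one_plus E x : int_gring a E x -> int_gring a E (one_plus x).
Proof.
move=> xE; apply: int_gringD; first exact: int_gring1.
apply: int_gringB => //; apply: int_gringM => //; exact: int_gring_group.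
Qed.

(** Since [(1 - z)^2 = 2 (1 - z)], the product of [1 + (1 - z) x] and [1 - (1 - z) x] is congruent
    to 1 modulo 2. Its determinant has absolute value 1, and neither factor exceeds 1. *)
Lemma one_plus_unit E x : int_gring a E x -> int_gring_unit_spec a E (one_plus x).
Proof.
move=> xE; have uE := int_gring_one_plus xE; apply: int_gring_unit_det => //.
have u'E := int_gring_one_plus (int_gringN xE).
have le1 (u : 'M[N]_#|G|) : int_gring a E u -> a (\det u) <= 1.
  move=> uE'; have : \det u \in val_ring a E.
    by apply: det_val_ring => i j; exact: int_gring_entry.
  by case/andP.
pose w := x *m x - aG z *m (x *m x).
have wE : int_gring a E w.
  have xx := int_gringM xE xE.
  apply: int_gringB => //; apply: int_gringM => //; exact: int_gring_group.
have prodE : one_plus x *m one_plus (- x) = 1%:M - 2%:R *: w.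
  pose y := x - aG z *m x.
  have -> : one_plus (- x) = 1%:M - y.
    by rewrite /one_plus mulmxN -opprD.
  rewrite /one_plus -/y mulmxDl mul1mx mulmxBr mulmx1 addrA subrK; congr (_ - _).
  have zc := gring_z_commute (int_gring_mem xE).
  rewrite {2}/y mulmxBr mulmxA /y !mulmxBl -zc.
  have -> : aG z *m x *m aG z = x.
    by rewrite -mulmxA -zc mulmxA -repr_mxM // z2 repr_mx1 mul1mx.
  by rewrite -!mulmxA opprB addrACA -opprD -!mulr2n -mulrnBl scaler_nat.
clearbody w; have d1 : a (\det (one_plus x) * \det (one_plus (- x))) = 1.
  apply: (@abs_eq1 _ _ _ 1); first exact: abs1.
  rewrite -det_mulmx prodE -[X in X - _](@det1 _ #|G|); apply: le_lt_trans a2.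
  apply: abs_det_dist => [|i j|i j|i j]; first exact: abs_ge0.
  - by have /andP[] := int_gring_entry i j (int_gring1 a G E).
  - have := int_gringM uE u'E; rewrite prodE => h.
    by have /andP[] := int_gring_entry i j h.
  have /andP[_ w1] := int_gring_entry i j wE.
  by rewrite !mxE subKr absM ler_piMr ?abs_ge0.
apply/eqP; rewrite eq_le le1 //= -d1 absM ler_piMr ?abs_ge0 //.
exact: le1.
Qed.

Lemma gring_op_one_plus (T : representation N G) E x : int_gring a E x ->
  gring_op T (one_plus x) = 1%:M + (gring_op T x - T z *m gring_op T x).
Proof.
move=> xE; rewrite /one_plus linearD linearB /= gring_op1.
by rewrite gring_opM ?(int_gring_mem xE) // gring_opG.
Qed.

End Units.

(** * Determinants of 1 + (1 - z) x *)

Section DetImage.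

Variables (gT : finGroupType) (G : {group gT}) (z : gT).
Hypothesis hG : (2.-group G)%g.
Hypothesis hz_central : z \in 'Z(G)%g.
Hypothesis hz_order : #[z]%g = 2%N.
Hypothesis hz_comm : exists x y : gT, [/\ x \in G, y \in G & z = [~ x, y]%g].
Hypothesis hG_ab : abelian (G / <[z]>)%g.
Variables (R : realType) (Q2 : fieldType) (a2 : nonarch_abs R Q2).
Hypothesis hQ2 : is_Qp 2 a2.
Variables (N : splittingFieldType Q2) (aN : nonarch_abs R N).
Hypothesis haN : forall x : Q2, aN x%:A = a2 x.
Hypothesis hroots : exists r : seq N, 'X^#|G| - 1 = \prod_(w <- r) ('X - w%:P).
Implicit Types (E : {subfield N}) (T : representation N G).

Let charN := charN0 hQ2 haN.
Let Gz := z_in hz_central.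
Local Notation aG := (regular_repr N G).

Definition faithful_irrs := {T : representation N G | faithful_irr z T}.
Local Notation I := faithful_irrs.
Definition irrs_char (i : I) x := central_char (sval i) x.
Local Notation C := (char_span aN 'Z(G)%G irrs_char).

Let irrI (i : I) : mx_irreducible (sval i).
Proof. by case: (svalP i). Qed.

Lemma irrs_char1 i : irrs_char i 1%g = 1.
Proof. exact: central_char1. Qed.

Lemma irrs_charM i :
  {in 'Z(G)%g &, {morph irrs_char i : x y / (x * y)%g >-> x * y}}.
Proof. exact: central_charM. Qed.

Lemma irrs_char_abs i x : x \in 'Z(G)%g -> aN (irrs_char i x) = 1.
Proof.
move=> Zx; apply/eqP; rewrite -(@pexpr_eq1 _ _ #|G|) ?abs_ge0 //.
have -> : aN (irrs_char i x) ^+ #|G| = aN (irrs_char i (x ^+ #|G|)%g).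
  rewrite -absX; congr (aN _).
  elim: #|G| => [|n IH]; first by rewrite expr0 expg0 irrs_char1.
  by rewrite exprS expgS irrs_charM ?groupX // IH.
have -> : (x ^+ #|G| = 1)%g.
  by apply/eqP; rewrite -order_dvdn order_dvdG // (subsetP (center_sub G)).
by rewrite irrs_char1 abs1.
Qed.

(** Taking the powers in the group ring yields one integral element valid for all [T] at once. *)
Lemma gring_op_iter E (u : 'M[N]_#|G|) k : int_gring aN E u ->
  exists2 v, int_gring aN E v &
    forall T, iter k (mulmx (gring_op T u)) (gring_op T u) = gring_op T v.
Proof.
move=> uE; elim: k => [|k [v vE IH]]; first by exists u.
exists (u *m v); first exact: int_gringM.
by move=> T; rewrite iterS IH gring_opM // (int_gring_mem vE).
Qed.

Lemma irrs_trace E (u : 'M[N]_#|G|) m : int_gring aN E u ->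
  (forall T, faithful_irr z T -> rdegree T = (2 ^ m)%N) ->
  C E (aN 2%:R ^+ m) (fun i => \tr (gring_op (sval i) u)).
Proof.
move=> [l lE ->] dT.
exists (fun x => (2 ^ m)%:R * l x); split=> [x|x|i].
- by rewrite rpredM ?rpred_nat //; have /andP[] := lE x.
- rewrite absM natrX absX ler_piMr ?exprn_ge0 ?abs_ge0 //.
  by have /andP[] := lE x.
rewrite gring_op_sum linear_sum /=.
rewrite (bigID (mem 'Z(G)%g)) /= [X in _ + X]big1 ?addr0.
  apply: eq_big => [x|x /andP[Gx Zx]].
    by apply: andb_idl; exact: (subsetP (center_sub G)).
  rewrite linearZ /= central_charE // mxtrace_scalar (dT _ (svalP i)).
  by rewrite mulrnAr -[LHS]mulr_natl mulrA.
move=> x /andP[Gx Zx]; rewrite linearZ /=.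
by rewrite (faithful_trace0 hz_central hz_order hG_ab charN (svalP i)) ?mulr0.
Qed.

(* With [r = |2|], the k-th elementary symmetric function times [2^k] is bounded
   by [r^(m+1)] by Newton's identities: the traces are bounded by [r^m], and
   [|k| >= r^m] for [k <= 2^m]. *)
Lemma irrs_det_bound E (u : 'M[N]_#|G|) m : int_gring aN E u ->
  (forall T, faithful_irr z T -> rdegree T = (2 ^ m)%N) ->
  exists2 c, C E 1 c & forall i : I,
    \det (1%:M + 2%:R *: gring_op (sval i) u) = 1 + (2 ^ m.+1)%:R * c i.
Proof.
move=> uE dT; set r := aN 2%:R.
have r0 : 0 < r := abs2_gt0 hQ2 haN.
have r1 : r < 1 := abs2_lt1 hQ2 haN.
pose e k (i : I) := (det_pencil (gring_op (sval i) u))`_k.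
have e0 i : e 0%N i = 1.
  by rewrite /e -horner_coef0 horner_det_pencil scale0r addr0 det1.
have main k : (k < 2 ^ m)%N -> C E (r ^+ m.+1) (fun i => 2%:R ^+ k.+1 * e k.+1 i).
  elim/ltn_ind: k => k IH km.
  have k0 : (k.+1)%:R != 0 :> N by apply: (natN_neq0 hQ2 haN).
  pose t j (i : I) := \tr (iter j (mulmx (gring_op (sval i) u)) (gring_op (sval i) u)).
  have Ct j : C E (r ^+ m) (t j).
    have [v vE vP] := gring_op_iter j uE.
    have := irrs_trace vE dT; congr char_span; apply/funext => i.
    by rewrite /t vP.
  have -> : (fun i => 2%:R ^+ k.+1 * e k.+1 i) = (fun i =>
      \sum_(j < k.+1) ((k.+1)%:R^-1 * (-1) ^+ j * 2%:R ^+ j.+1) *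
         (t j i * (2%:R ^+ (k - j) * e (k - j)%N i))).
    apply/funext => i; apply: (mulfI k0).
    transitivity (2%:R ^+ k.+1 * (e k.+1 i *+ k.+1)).
      by rewrite mulrCA mulr_natl.
    rewrite /e newton_identity !mulr_sumr; apply: eq_bigr => j _.
    have -> : 2%:R ^+ k.+1 = 2%:R ^+ j.+1 * 2%:R ^+ (k - j) :> N.
      by rewrite -exprD addSn subnKC // -ltnS.
    by rewrite !mulrA mulfV // mul1r -/(t j i); ring.
  apply: (char_span_sum irrs_char1) => [|j _]; first by rewrite exprn_ge0 // ltW.
  have coefE : (k.+1)%:R^-1 * (-1) ^+ j * 2%:R ^+ j.+1 \in E.
    by rewrite !rpredM ?rpredV ?rpredX ?rpredN ?rpred_nat ?rpred1.
  have coef_abs : aN ((k.+1)%:R^-1 * (-1) ^+ j * 2%:R ^+ j.+1) <=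
      (aN (k.+1)%:R)^-1 * r ^+ j.+1.
    by rewrite !absM absV !absX absN1 expr1n mulr1.
  have ak : 0 < aN (k.+1)%:R by rewrite lt_def abs_eq0 k0 abs_ge0.
  (* For [j = k] the factor [e 0 = 1] carries no bound [r ^+ m.+1]; the division by [k.+1] is
     absorbed by [r ^+ k <= aN (k.+1)%:R], from [k.+1 <= 2 ^ k]. Otherwise [r ^+ m <= aN (k.+1)%:R]
     suffices. *)
  have [jk|jk] := eqVneq (k - j)%N 0%N.
    have jE : (j : nat) = k by apply/eqP; rewrite eqn_leq -ltnS ltn_ord -subn_eq0 jk.
    have -> : (fun i => (k.+1)%:R^-1 * (-1) ^+ j * 2%:R ^+ j.+1 *
        (t j i * (2%:R ^+ (k - j) * e (k - j)%N i))) =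
      (fun i => (k.+1)%:R^-1 * (-1) ^+ j * 2%:R ^+ j.+1 * t j i).
      by apply/funext => i; rewrite jk e0 expr0 !mulr1.
    apply: char_span_le (char_spanZ coefE coef_abs (Ct j)).
    rewrite -mulrA ler_pdivrMl // jE -exprD addSn -addnS exprD.
    rewrite ler_wpM2r ?exprn_ge0 ?(ltW r0) //.
    by apply: (abs_natr_ge hQ2 haN) => //; exact: ltn_expl.
  have CI : C E (r ^+ m.+1) (fun i => 2%:R ^+ (k - j) * e (k - j)%N i).
    have lt : ((k - j).-1 < k)%N by move: jk; clear; lia.
    have := IH _ lt (ltn_trans lt km).
    by rewrite prednK // lt0n.
  have := char_spanZ coefE coef_abs (char_spanM irrs_charM (Ct j) CI).
  apply: char_span_le.
  rewrite -mulrA ler_pdivrMl // mulrA ler_wpM2r ?exprn_ge0 ?(ltW r0) //.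
  apply: (@le_trans _ _ (r ^+ m)).
    by rewrite ler_piMl ?exprn_ge0 ?exprn_ile1 ?ltW.
  exact: (abs_natr_ge hQ2 haN).
have p2 : (2 ^ m.+1)%:R != 0 :> N by apply: (natN_neq0 hQ2 haN); rewrite expn_gt0.
pose c i := (2 ^ m.+1)%:R^-1 * \sum_(k < 2 ^ m) 2%:R ^+ k.+1 * e k.+1 i.
exists c => [|i].
  have CS : C E (r ^+ m.+1) (fun i => \sum_(k < 2 ^ m) 2%:R ^+ k.+1 * e k.+1 i).
    by apply: (char_span_sum irrs_char1) => [|k _]; [rewrite exprn_ge0 // ltW|exact: main].
  have pE : (2 ^ m.+1)%:R^-1 \in E by rewrite rpredV rpred_nat.
  have := char_spanZ pE (lexx _) CS.
  by rewrite absV [X in aN X]natrX absX -/r mulVf ?expf_neq0 ?gt_eqF.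
rewrite /c mulrA mulfV // mul1r -horner_det_pencil.
rewrite (@horner_coef_wide _ (2 ^ m).+1); last first.
  by apply: leq_trans (size_det_pencil _) _; rewrite (dT _ (svalP i)).
rewrite big_ord_recl -/(e 0%N i) e0 expr0 mulr1; congr (_ + _).
by apply: eq_bigr => k _; rewrite mulrC.
Qed.

(* character.v also has a [det_repr]. *)
Local Notation det_repr := Defs.det_repr.

Lemma Det_class E (u : int_gring_unit aN G E) T :
  Det u (K0_class T) = det_repr u T.
Proof.
apply: K0_lift_class; [exact: det_repr_rsim|exact: det_repr_dadd|].
exact: det_repr_neq0.
Qed.

Lemma K0_irr_ext (f g : K0 N G -> N) :
  (forall x, f x != 0) -> (forall x, g x != 0) ->
  {morph f : x y / x + y >-> x * y} -> {morph g : x y / x + y >-> x * y} ->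
  (forall T, mx_irreducible T -> f (K0_class T) = g (K0_class T)) -> f =1 g.
Proof.
move=> f0 g0 fD gD fg.
have one h : (forall x, h x != 0) -> {morph h : x y / x + y >-> x * y} ->
    h (0 : K0 N G) = 1 :> N.
  by move=> h0 hD; apply: (mulfI (h0 0)); rewrite -hD addr0 mulr1.
have fgT T : f (K0_class T) = g (K0_class T).
  move: T; apply: repr_irr_ind => [|A B /K0_class_rsim -> //|A B fA fB||] //.
  - by apply: pgroup_char0; exact: charN.
  - by rewrite K0_class_dadd fD gD fA fB.
  - have -> : K0_class (@grepr0 N gT G) = 0 by [].
    by rewrite !one.
have opp h : (forall x, h x != 0) -> {morph h : x y / x + y >-> x * y} ->
    forall x : K0 N G, h (- x) = (h x)^-1 :> N.
  move=> h0 hD x; apply: (mulfI (h0 x)).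
  by rewrite -hD subrr one // divff.
by apply: K0_gen => A B; rewrite fD gD !opp // !fgT.
Qed.

Lemma det_repr_one_plus E x T : int_gring aN E x -> faithful_irr z T ->
  det_repr (one_plus z x) T = \det (1%:M + 2%:R *: gring_op T x).
Proof.
move=> xE [_ Tz]; rewrite /det_repr (gring_op_one_plus Gz _ xE) Tz.
by rewrite mul_scalar_mx scaleN1r opprK -mulr2n scaler_nat.
Qed.

Lemma det_repr_one_plus_linear E x T : int_gring aN E x -> T z = 1%:M ->
  det_repr (one_plus z x) T = 1.
Proof.
move=> xE Tz; rewrite /det_repr (gring_op_one_plus Gz _ xE) Tz.
by rewrite mul1mx subrr addr0 det1.
Qed.

Lemma one_plus_int_unit E (x : 'M[N]_#|G|) : int_gring aN E x ->
  int_gring_unit_spec (G := G) aN E (one_plus z x).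
Proof.
apply: one_plus_unit => //; first exact: z_commute.
  exact: z_sqr.
exact: (abs2_lt1 hQ2 haN).
Qed.

(** Extracting a [2 ^ m]-th root turns the target into [(1 + 4 f)^(2^m)], the shape in which the
    explicit units have their determinants, so that [char_span_generation] applies to [f]. *)
Lemma det_lower_bound E m c : (forall T, faithful_irr z T -> rdegree T = (2 ^ m.+1)%N) ->
  C E 1 c ->
  exists v : int_gring_unit aN G E,
    (forall T, T z = 1%:M -> det_repr v T = 1) /\
    (forall i : I, det_repr v (sval i) = 1 + (2 ^ m.+2)%:R * c i).
Proof.
move=> dT Cc.
have [f Cf fE] := char_span_pow2_root hQ2 haN irrs_char1 irrs_charM irrs_char_abs m Cc.
pose V f := exists v : int_gring_unit aN G E,
    (forall T, T z = 1%:M -> det_repr v T = 1) /\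
    (forall i : I, det_repr v (sval i) = (1 + 4%:R * f i) ^+ (2 ^ m)).
suff [v [v1 vf]] : V f by exists v; split=> // i; rewrite vf fE.
pose S := [pred y | [exists x in G, (x \notin 'Z(G)%g) && (y == x ^+ 2)%g]].
apply: (@char_span_generation _ _ _ hQ2 _ _ haN _ _ _ _ irrs_char1 irrs_charM
  irrs_char_abs E V S) (Cf).
- move=> g h Cg Ch [v [v1 vg]] [w [w1 wh]]; exists (v * w)%g.
  have wG := int_gring_mem (gring_unit_int w).
  split=> [T Tz|i]; rewrite det_reprM //; first by rewrite v1 // w1 // mulr1.
  by rewrite vg wh -exprMn; congr (_ ^+ _); ring.
(* The central element [x] acts as the scalar [g i], and [(1 + 2 g)^(2^(m+1)) = (1 + 4 (g +
   g^2))^(2^m)]. *)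
- move=> g [l [lE l1 gE]].
  pose x := \sum_(y in G) (if y \in 'Z(G)%g then l y else 0) *: aG y.
  have xE : int_gring aN E x.
    exists (fun y => if y \in 'Z(G)%g then l y else 0) => // y.
    by case: ifP => _; [rewrite inE lE l1|exact: val_ring0].
  exists (IntGringUnit (asboolT (one_plus_int_unit xE))).
  split=> [T Tz|i] /=; first exact: det_repr_one_plus_linear xE Tz.
  rewrite (det_repr_one_plus xE (svalP i)).
  have -> : gring_op (sval i) x = (g i)%:M.
    rewrite gring_op_sum gE raddf_sum /= (bigID (mem 'Z(G)%g)) /= [X in _ + X]big1.
      rewrite addr0; apply: eq_big => [y|y /andP[Gy Zy]].
        by apply: andb_idl; exact: (subsetP (center_sub G)).
      by rewrite Zy (central_charE charN hroots) // scale_scalar_mx.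
    by move=> y /andP[_ /negPf->]; rewrite scale0r.
  rewrite scale_scalar_mx -raddfD det_scalar (dT _ (svalP i)) expnS exprM.
  by congr (_ ^+ _); ring.
- move=> c0 y c0E c01 /existsP[x /and3P[Gx Zx /eqP->]].
  have xE : int_gring aN E (c0 *: aG x).
    exists (fun h => if h == x then c0 else 0) => [h|].
      by case: ifP => _; [rewrite inE c0E|exact: val_ring0].
    rewrite (bigD1 x) //= eqxx big1 ?addr0 // => h /andP[_ /negPf->].
    by rewrite scale0r.
  exists (IntGringUnit (asboolT (one_plus_int_unit xE))).
  split=> [T Tz|i] /=; first exact: det_repr_one_plus_linear xE Tz.
  rewrite (det_repr_one_plus xE (svalP i)) linearZ /= gring_opG // scalerA.
  rewrite (faithful_det hz_central hz_order hG_ab charN hroots _ (svalP i) (dT _ (svalP i)) Gx Zx).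
  by congr (_ ^+ _); rewrite /irrs_char; ring.
- by move=> y /existsP[x /and3P[Gx _ /eqP->]]; exact: (sqr_central hz_central hz_order hG_ab).
- have [x Gx Zx] := exists_noncentral hz_order hz_comm.
  by exists (x ^+ 2)%g; apply/existsP; exists x; rewrite Gx Zx eqxx.
exact: pgroupS (center_sub G) hG.
Qed.

End DetImage.

(** * Galois descent *)

Section Descent.

Variables (gT : finGroupType) (G : {group gT}) (z : gT).
Hypothesis hG : (2.-group G)%g.
Hypothesis hz_central : z \in 'Z(G)%g.
Hypothesis hz_order : #[z]%g = 2%N.
Hypothesis hz_comm : exists x y : gT, [/\ x \in G, y \in G & z = [~ x, y]%g].
Hypothesis hG_ab : abelian (G / <[z]>)%g.
Variables (R : realType) (Q2 : fieldType) (a2 : nonarch_abs R Q2).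
Hypothesis hQ2 : is_Qp 2 a2.
Variables (N : splittingFieldType Q2).
Hypothesis hN : galois 1 {:N}.
Variable aN : nonarch_abs R N.
Hypothesis haN : forall x : Q2, aN x%:A = a2 x.
Hypothesis hroots : exists r : seq N, 'X^#|G| - 1 = \prod_(w <- r) ('X - w%:P).
Variables (K M : {subfield N}).
Hypothesis hKM : galois K M.
Implicit Types (T : representation N G) (t : gal_of {:N}).

Local Notation det_repr := Defs.det_repr.
Local Notation aG := (regular_repr N G).
Let charN := charN0 hQ2 haN.
Let G'N : ([pchar N]^'.-group G)%g := pgroup_char0 charN G.

Lemma galois_fixed_mem (x : N) : (forall t, t \in 'Gal({:N} / K)%g -> t x = x) ->
  x \in K.
Proof.
have gK : galois K {:N} by apply: galoisS hN; rewrite sub1v subvf.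
by move=> tx; have /galois_fixedField <- := gK; apply/fixedFieldP; rewrite ?memvf.
Qed.

Lemma gal_restrict t : t \in 'Gal({:N} / K)%g ->
  exists2 s : gal_of M, s \in 'Gal(M / K)%g & {in M, t =1 s}.
Proof.
have /and3P[sKM _ nKM] := hKM; move=> tK.
have kt : kAut K M t.
  apply: (@normalField_kAut _ _ K M {:N}) => //; first by rewrite sKM subvf.
  by rewrite -gal_kAut ?subvf.
by have [s sK ts] := kAut_to_gal kt; exists s.
Qed.

Lemma gal_invK t : cancel (t : N -> N) (t^-1%g : gal_of {:N}).
Proof. by move=> x; rewrite -galM ?memvf // mulgV gal_id. Qed.

Lemma gal_invKV t : cancel (t^-1%g : gal_of {:N}) (t : N -> N).
Proof. by move=> x; rewrite -galM ?memvf // mulVg gal_id. Qed.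

Local Notation conjT t T := (grepr_map (gal_repr t : {rmorphism N -> N}) T).

Lemma conjT_irr t T : mx_irreducible T -> mx_irreducible (conjT t T).
Proof. exact: map_repr_irr (gal_invK t). Qed.

Lemma conjT_invK t T x : conjT t (conjT t^-1%g T) x = T x.
Proof. by apply/matrixP => i j; rewrite !mxE; exact: gal_invKV. Qed.

Lemma conjT_z t T (e : N) : t e = e -> T z = e%:M -> conjT t T z = e%:M.
Proof.
by move=> te Tz; rewrite /= /map_repr_mx Tz map_scalar_mx /= te.
Qed.

Lemma conjT_faithful t T : faithful_irr z T -> faithful_irr z (conjT t T).
Proof.
move=> [irrT Tz]; split; first exact: conjT_irr.
by apply: conjT_z Tz; rewrite rmorphN1.
Qed.

Lemma conjT_char t T x :
  central_char (conjT t T) x = t (central_char T x).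
Proof. by rewrite /central_char fmorph_div rmorph_nat /= /map_repr_mx -trace_map_mx. Qed.

Lemma det_degree1_inj n (A B : 'M[N]_n) : n = 1%N -> \det A = \det B -> A = B.
Proof.
case: n A B => [|[|n]] A B // _.
by rewrite [A]mx11_scalar [B]mx11_scalar !det_scalar !expr1 => ->.
Qed.

Lemma sum_shift_z (f : gT -> N) T :
  \sum_(g in G) f (z * g)%g *: T g = T z *m \sum_(g in G) f g *: T g.
Proof.
have Gz := z_in hz_central.
rewrite mulmx_sumr [RHS](reindex_inj (mulgI z)) /=.
apply: eq_big => [g|g Gg]; first by rewrite (z_mul_in hz_central).
by rewrite -scalemxAr -repr_mxM ?groupM // (z_mulK hz_order).
Qed.

Lemma int_gring_widen (u : 'M[N]_#|G|) : int_gring aN K u -> int_gring aN M u.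
Proof.
have /and3P[sKM _ _] := hKM; move=> [l lK ->]; exists l => // g.
by have := lK g; rewrite !inE => /andP[/(subvP sKM) -> ->].
Qed.

Lemma int_gring_unit_widen (u : 'M[N]_#|G|) :
  int_gring_unit_spec aN K u -> int_gring_unit_spec aN M u.
Proof.
move=> [uK [v vK uv]]; split; first exact: int_gring_widen.
by exists v => //; exact: int_gring_widen.
Qed.

Lemma int_gring_unit_abs_det E (u : 'M[N]_#|G|) :
  int_gring_unit_spec aN E u -> aN (\det u) = 1.
Proof.
move=> [uE [v vE [uv _]]].
have le1 (w : 'M[N]_#|G|) : int_gring aN E w -> aN (\det w) <= 1.
  move=> wE; have : \det w \in val_ring aN E.
    by apply: det_val_ring => i j; exact: int_gring_entry.
  by case/andP.
apply/eqP; rewrite eq_le le1 //=.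
rewrite -(abs1 aN) -(@det1 _ #|G|) -uv det_mulmx absM ler_piMr ?abs_ge0 //.
exact: le1.
Qed.

(** Invariance of [Det u] under Gal(M/K): as that action is computed through lifts, it amounts to
    equivariance under all of Gal(N/K). *)
Definition gal_equivariant (u : int_gring_unit aN G M) :=
  forall t, t \in 'Gal({:N} / K)%g -> forall T,
  det_repr u (conjT t T) = t (det_repr u T).

(* On degree one representations [u] is determined by [l g + l (z g)]; moving
   these sums to one representative of each coset of [z] gives the factor over
   [K]. *)
Lemma equivariant_factor (u : int_gring_unit aN G M) : gal_equivariant u ->
  exists v : int_gring_unit aN G K,
  exists2 x, int_gring aN M x & (u : 'M_#|G|) = v *m one_plus z x.
Proof.
move=> ueq; have [l lM uE] := gring_unit_int u.
have Gz := z_in hz_central.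
(* In degree one the determinant determines the matrix, so equivariance becomes linear in the
   coefficients. Starting from the conjugate by [t^-1] lets [t] move the coefficients only. *)
have lin t T : t \in 'Gal({:N} / K)%g -> mx_irreducible T -> T z = 1%:M ->
    \sum_(g in G) (t (l g) - l g) *: T g = 0.
  move=> tK irrT Tz; pose T' := conjT t^-1%g T.
  have dT := irr_linear hz_central hz_order hG_ab hroots irrT Tz.
  have := ueq t tK T'; rewrite uE !det_reprE -[RHS]det_map_mx => h.
  have {h} := det_degree1_inj dT h; rewrite map_mx_sum.
  move=> h; under eq_bigr do rewrite scalerBl.
  rewrite sumrB; apply/eqP; rewrite subr_eq0; apply/eqP.
  transitivity (\sum_(g in G) map_mx t (l g *: T' g)).
    by apply: eq_bigr => g _; rewrite map_mxZ -(conjT_invK t).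
  rewrite -h; apply: eq_bigr => g _; congr (_ *: _).
  exact: (conjT_invK t T).
have fixl g : g \in G -> l g + l (z * g)%g \in K.
  move=> Gg; apply: galois_fixed_mem => t tK.
  (* The sums of [d'] against irreducible representations vanish: by [lin] where [z = 1], and
     because [d'] is invariant under [z] where [z = -1]. *)
  pose d h := (t (l h) - l h); pose d' h := d h + d (z * h)%g.
  suff : d' g = 0.
    rewrite /d' /d addrACA -opprD => /eqP; rewrite subr_eq0 => /eqP.
    by rewrite rmorphD.
  apply: (irr_gring_coef_eq0 G'N) (Gg) => T irrT.
  under eq_bigr do rewrite scalerDl.
  rewrite big_split /= sum_shift_z.
  have [Tz|Tz] := irr_z hz_central hz_order charN hroots irrT.
    by rewrite (lin t) // mulmx0 addr0.
  by rewrite Tz mul_scalar_mx scaleN1r addrN.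
have halfz := halfE hz_order.
pose lt g := if (g \in G) && half z g then l g + l (z * g)%g else 0.
have ltK g : lt g \in val_ring aN K.
  rewrite /lt; case: ifP => [/andP[Gg _]|_]; last exact: val_ring0.
  rewrite inE fixl //=; have /andP[_ ?] := lM g.
  by have /andP[_ ?] := lM (z * g)%g; apply: absD_le.
pose v := \sum_(g in G) lt g *: aG g.
have vK : int_gring aN K v by exists lt.
(* Chosen so that [u = v + (1 - z) w]: on a selected [g] the coefficient is [- l (z * g)], which the
   factor [1 - z] moves back to [z * g]. *)
pose lw g := if half z g then l g - lt g else 0.
have ltM g : lt g \in val_ring aN M.
  have /and3P[sKM _ _] := hKM.
  by have := ltK g; rewrite !inE => /andP[/(subvP sKM) -> ->].
pose w := \sum_(g in G) lw g *: aG g.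
have wM : int_gring aN M w.
  exists lw => // g; rewrite /lw; case: ifP => _; last exact: val_ring0.
  have /andP[E1 A1] := lM g; have /andP[E2 A2] := ltM g.
  by rewrite inE rpredB //=; apply: absB_le.
have uvw : (u : 'M_#|G|) = v + (w - aG z *m w).
  rewrite uE /w -(sum_shift_z lw (Representation aG)) /= -sumrB -big_split /=.
  apply: eq_bigr => g Gg; rewrite -scalerBl -scalerDl; congr (_ *: _).
  rewrite /lw halfz /lt Gg (z_mul_in hz_central) Gg (z_mulK hz_order) halfz /=.
  by case: (half z g) => /=; ring.
have uM := gring_unit_int u.
have uspec : int_gring_unit_spec aN M u by have /asboolP := gring_unitP u.
have vspec : int_gring_unit_spec aN K v.
  apply: int_gring_unit_det => //.
  (* Over [M], [v = u (1 + (1 - z) y)] is a product of units, so its determinant has absolute value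
     1; this makes [v] a unit already over [K]. *)
  pose y := - (invmx u *m w).
  have uVM : int_gring aN M (invmx u) by have [] := asboolP _ (gring_unitV_subproof u).
  have yM : int_gring aN M y by apply: int_gringN; exact: int_gringM.
  have Uu := gring_unit_unitmx u.
  have -> : v = u *m one_plus z y.
    rewrite /one_plus mulmxDr mulmx1 mulmxBr mulmxA.
    rewrite -(gring_z_commute Gz _ (int_gring_mem uM)); last exact: z_commute.
    have uy : u *m y = - w by rewrite /y mulmxN mulKVmx.
    rewrite -mulmxA uy mulmxN opprK uvw -addrA [- w + _]addrC -opprB.
    by rewrite addNr addr0.
  rewrite det_mulmx absM (int_gring_unit_abs_det uspec) mul1r.
  apply: (@int_gring_unit_abs_det M).
  exact: (one_plus_int_unit hz_central hz_order hQ2 haN).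
exists (IntGringUnit (asboolT vspec)).
have vM := int_gring_widen vK.
have Uv := gring_unit_unitmx (IntGringUnit (asboolT vspec)).
exists (invmx v *m w).
  apply: int_gringM => //; apply: int_gring_widen.
  by have [] := asboolP _ (gring_unitV_subproof (IntGringUnit (asboolT vspec))).
rewrite /one_plus mulmxDr mulmx1 mulmxBr mulmxA /=.
rewrite [X in _ - X]mulmxA -(gring_z_commute Gz _ (int_gring_mem vM)); last exact: z_commute.
by rewrite -[X in _ - X]mulmxA mulKVmx // uvw mulmxV // mul1mx.
Qed.

Local Notation I := (faithful_irrs G z N).
Local Notation C := (char_span aN 'Z(G)%G (@irrs_char gT G z Q2 N)).

Definition conj_irr t (i : I) : I :=
  exist _ (conjT t (sval i)) (conjT_faithful t (svalP i)).

(* Any coefficients can be moved to one representative of each coset of [z]; in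
   this normal form they are determined by the function on the characters. *)
Lemma char_span_descent (c : I -> N) : C M 1 c ->
  (forall t, t \in 'Gal({:N} / K)%g -> forall i, c (conj_irr t i) = t (c i)) ->
  C K 1 c.
Proof.
move=> [l [lM l1 cE]] ceq.
have zZ := z_mulZ_in hz_central; have zK := z_mulK hz_order.
have halfz := halfE hz_order.
pose ln x := if (x \in 'Z(G)%g) && half z x then l x - l (z * x)%g else 0.
have psi_z (i : I) x : x \in 'Z(G)%g -> irrs_char i (z * x)%g = - irrs_char i x.
  have [irrT Tz] := svalP i; move=> Zx.
  rewrite (irrs_charM hQ2 haN hroots) // -mulN1r; congr (_ * _).
  apply: (scalar_mx_inj_gt0 (irr_rdegree_gt0 irrT)).
  by rewrite -Tz /irrs_char -(central_charE charN hroots irrT).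
have cN i : c i = \sum_(x in 'Z(G)%g) ln x * irrs_char i x.
  transitivity (\sum_(x in 'Z(G)%g | half z x) (l x - l (z * x)%g) * irrs_char i x).
    rewrite cE (bigID (half z)) /= [X in _ + X](reindex_inj (mulgI z)) /=.
    have -> : \sum_(x | (z * x \in 'Z(G))%g && ~~ half z (z * x)%g)
        l (z * x)%g * irrs_char i (z * x)%g =
        \sum_(x in 'Z(G)%g | half z x) l (z * x)%g * - irrs_char i x.
      apply: eq_big => [x|x /andP[Zx _]]; first by rewrite zZ halfz negbK.
      by rewrite psi_z // -zZ.
    by rewrite -big_split /=; apply: eq_bigr => x _; rewrite mulrN mulrBl.
  rewrite [RHS](bigID (half z)) /= [X in _ = _ + X]big1 ?addr0.
    by apply: eq_bigr => x /andP[Zx hx]; rewrite /ln Zx hx.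
  by move=> x /andP[_ /negPf hx]; rewrite /ln hx andbF mul0r.
exists ln; split=> // x; last first.
  by rewrite /ln; case: ifP => _; rewrite ?abs0 ?ler01 //; apply: absB_le.
have [Zx|Zx] := boolP (x \in 'Z(G)%g); last first.
  by rewrite /ln (negPf Zx) mem0v.
apply: galois_fixed_mem => t tK; pose d y := t (ln y) - ln y.
have d0 (j : I) : \sum_(y in 'Z(G)%g) d y * irrs_char j y = 0.
  have := ceq t tK (conj_irr t^-1%g j); rewrite !cN rmorph_sum /=.
  have e y : irrs_char (conj_irr t (conj_irr t^-1%g j)) y = irrs_char j y.
    by rewrite /irrs_char /= conjT_char conjT_char gal_invKV.
  move/esym/eqP; rewrite -subr_eq0 -sumrB => /eqP h.
  rewrite -[RHS]h; apply: eq_bigr => y _.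
  rewrite rmorphM /= mulrBl e; congr (_ * _ - _).
  by rewrite /irrs_char /= conjT_char gal_invKV.
(* With [d] extended by 0 off the centre, [d g - d (z * g)] sums to 0 against representations with
   [z = 1] by cancellation, and against those with [z = -1] by [d0]. *)
have := @irr_gring_coef_eq0 _ _ G G'N
  (fun g => (if g \in 'Z(G)%g then d g else 0) -
            (if (z * g \in 'Z(G))%g then d (z * g)%g else 0)).
have sumD T : mx_irreducible T ->
    \sum_(g in G) (if g \in 'Z(G)%g then d g else 0) *: T g =
    (\sum_(y in 'Z(G)%g) d y * central_char T y)%:M.
  move=> irrT; rewrite raddf_sum /= (bigID (mem 'Z(G)%g)) /= [X in _ + X]big1.
    rewrite addr0; apply: eq_big => [y|y /andP[_ Zy]].
      by apply: andb_idl; exact: (subsetP (center_sub G)).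
    by rewrite Zy (central_charE charN hroots) // scale_scalar_mx.
  by move=> y /andP[_ /negPf->]; rewrite scale0r.
move/(_ _ x (subsetP (center_sub G) x Zx)); rewrite Zx zZ Zx => dz.
have {}dz : d x = d (z * x)%g.
  apply/eqP; rewrite -subr_eq0 dz // => T irrT.
  under eq_bigr do rewrite scalerBl.
  rewrite sumrB (sum_shift_z (fun g => if g \in 'Z(G)%g then d g else 0)).
  rewrite sumD //.
  have [Tz|Tz] := irr_z hz_central hz_order charN hroots irrT.
    by rewrite Tz mul1mx subrr.
  by rewrite (d0 (exist _ T (conj irrT Tz))) raddf0 mulmx0 subrr.
apply/eqP; rewrite -subr_eq0 -/(d x).
(* [d] vanishes off the selected half, and one of [x] and [z * x] is not selected. *)
case hx: (half z x); last by rewrite /d /ln hx andbF rmorph0 subrr.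
by rewrite dz /d /ln halfz hx andbF rmorph0 subrr.
Qed.

(** Write [u = v (1 + (1 - z) x)] with [v] over [K]. Where [z = -1] the second factor has
    determinants [1 + 2^(m+2) c]; dividing the equivariance of [u] by that of [v] makes [c]
    equivariant, so [c] descends to [K] and is realized there by a unit [w]. *)
Lemma det_descent (u : int_gring_unit aN G M) : gal_equivariant u ->
  exists v : int_gring_unit aN G K, Det v =1 Det u.
Proof.
move=> ueq; have [v [x xM uE]] := equivariant_factor ueq.
have [[//|m] _ dT] := faithful_degree_pow2 hG hz_central hz_order hz_comm hG_ab charN hroots.
have [c Cc cE] := irrs_det_bound hz_central hz_order hG_ab hQ2 haN hroots xM dT.
have Gz := z_in hz_central.
have pE := int_gring_one_plus Gz xM.
have detuE T : det_repr u T = det_repr v T * det_repr (one_plus z x) T.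
  by rewrite uE det_reprM // (int_gring_mem pE).
have cK : C K 1 c.
  apply: char_span_descent Cc _ => t tK i.
  have p2 : (2 ^ m.+2)%:R != 0 :> N by apply: (natN_neq0 hQ2 haN); rewrite expn_gt0.
  apply: (mulfI p2); apply: (addrI 1); rewrite -cE.
  rewrite -(det_repr_one_plus hz_central xM (svalP (conj_irr t i))).
  apply: (mulfI (det_repr_neq0 v (sval (conj_irr t i)))).
  rewrite -detuE ueq // detuE rmorphM /= det_repr_gal //; congr (_ * _).
  rewrite (det_repr_one_plus hz_central xM (svalP i)) cE.
  by rewrite rmorphD rmorphM /= rmorph1 rmorph_nat.
have [w [w1 wE]] := det_lower_bound hG hz_central hz_order hz_comm hG_ab hQ2 haN hroots dT cK.
exists (v * w)%g.
have DetD E (y : int_gring_unit aN G E) : {morph Det y : a b / a + b >-> a * b}.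
  by move=> a b; exact: gal_homD.
apply: (K0_irr_ext hQ2 haN); try exact: gal_hom_neq0; try exact: DetD.
move=> T irrT; rewrite !Det_class detuE det_reprM; last first.
  exact: int_gring_mem (gring_unit_int w).
congr (_ * _).
have [Tz|Tz] := irr_z hz_central hz_order charN hroots irrT.
  by rewrite w1 // (det_repr_one_plus_linear hz_central xM Tz).
have fT : faithful_irr z T by [].
have := wE (exist _ T fT); rewrite -cE /= => ->.
by rewrite (det_repr_one_plus hz_central xM fT).
Qed.

End Descent.

(** * The isomorphism, which keeps the underlying functions on [K0] *)

Theorem proposition3p6
  (gT : finGroupType) (G : {group gT}) (z : gT)
  (hG : (2.-group G)%g)
  (hz_central : z \in 'Z(G)%g)
  (hz_order : #[z]%g = 2%N)
  (hz_comm : exists x y : gT, [/\ x \in G, y \in G & z = [~ x, y]%g])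
  (hG_ab : abelian (G / <[z]>)%g)
  (R : realType) (Q2 : fieldType) (a2 : nonarch_abs R Q2) (hQ2 : is_Qp 2 a2)
  (N : splittingFieldType Q2) (hN : galois 1 {:N})
  (aN : nonarch_abs R N) (haN : forall x : Q2, aN x%:A = a2 x)
  (hroots : exists r : seq N, 'X^#|G| - 1 = \prod_(w <- r) ('X - w%:P))
  (K M : {subfield N}) (hKM : galois K M) :
  exists phi : {multiplicative det_invariants aN G K M -> det_group aN G K},
    bijective phi /\ (forall (f : det_invariants aN G K M) (x : K0 N G), phi f x = f x).
Proof.
have sKM : (K <= M)%VS by case/and3P: hKM.
have down (f : det_invariants aN G K M) :
    exists g : det_group aN G K, forall x, g x = f x.
  (* [gal_act] twists the argument by the inverse, so invariance is used for [t^-1], a lift of its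
     own restriction to [M]. *)
  have f_gal t : t \in 'Gal({:N} / K)%g -> forall x, f (K0_gal t x) = t (f x).
    move=> tK x; have [s sK ts] := gal_restrict hKM (groupVr tK).
    have /asboolP/(_ s sK _ (groupVr tK) ts x) := det_invariantsP f.
    by rewrite /gal_act invgK => <-; rewrite gal_invKV.
  have /asboolP[u uf] := det_groupP (det_invariants_val f).
  have ueq : gal_equivariant K u.
    move=> t tK T; rewrite -!Det_class uf -[X in _ = t X]/(f (K0_class T)).
    by rewrite -f_gal // /K0_gal K0_map_class.
  have [v vu] := det_descent hG hz_central hz_order hz_comm hG_ab hQ2 hN haN
    hroots hKM ueq.
  have vD : Det v \in @Det_image _ _ _ aN _ G K by apply/asboolP; exists v.
  by exists (DetGroup vD) => x; have := vu x; rewrite uf.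
(* A unit over [K] is a unit over [M], and invariance of its determinant is the Galois equivariance
   built into [gal_hom] over [K]. *)
have up (g : det_group aN G K) :
    exists f : det_invariants aN G K M, forall x, f x = g x.
  have /asboolP[v vg] := det_groupP g.
  have vspec := int_gring_unit_widen hKM (asboolW (gring_unitP v)).
  pose u := IntGringUnit (asboolT vspec).
  have uD : Det u \in @Det_image _ _ _ aN _ G M by apply/asboolP; exists u.
  have ug x : Det u x = g x by rewrite -vg.
  have uI : DetGroup uD \in @Gal_fixed _ _ _ aN _ G K M.
    apply/asboolP => s _ t tK _ x; rewrite /gal_act -!/(Det u _) !ug.
    by rewrite gal_hom_gal ?groupV // gal_invKV.
  by exists (DetInvariants uI).
have [phi phiE] := choice down; have [psi psiE] := choice up.
have inv_ext (f g : det_invariants aN G K M) : (forall x, f x = g x) -> f = g.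
  by move=> fg; do 2!apply: val_inj; exact: gal_hom_eq.
have grp_ext (f g : det_group aN G K) : (forall x, f x = g x) -> f = g.
  by move=> fg; apply: val_inj; exact: gal_hom_eq.
have phiM : {morph phi : f g / (f * g)%g}.
  by move=> f g; apply: grp_ext => x; rewrite phiE /= !phiE.
pose phi' : {multiplicative det_invariants aN G K M -> det_group aN G K} :=
  HB.pack phi (isMultiplicative.Build _ _ phi phiM).
exists phi'; split=> //; exists psi => [f|g].
  by apply: inv_ext => x; rewrite psiE phiE.
by apply: grp_ext => x; rewrite phiE psiE.
Qed.
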